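(* Let $n\ge 1$ be an integer and let $\Omega\subset\mathbf{R}^{n}$ be a bounded domain with piecewise smooth boundary $\partial\Omega$. Let $0<\lambda_1<\lambda_2\le\lambda_3\le\cdots$ be the eigenvalues, repeated according to multiplicity, of the Dirichlet problem $\Delta u=-\lambda u$ in $\Omega$, $u=0$ on $\partial\Omega$, and let $\{u_j\}_{j\ge1}$ be corresponding real orthonormal eigenfunctions. Then there exists a Cartesian coordinate system $(z_1,\dots,z_n)$ of $\mathbf{R}^n$ such that, for all positive integers $k$ and $l$, $$\sum_{\alpha=1}^{n}\frac{\lambda_{k+1}-\lambda_1}{1+\sum_{j=\alpha+1}^{k}(\lambda_{k+1}-\lambda_j)a_{\alpha j}^{2}}\le 3\lambda_1+\frac{\lambda_1^{2}}{\sigma_l},$$ where $$a_{\alpha j}=\int_{\Omega}z_{\alpha}u_1u_j\quad(1\le\alpha\le n,\ j\ge1),$$ $$\sigma_l=\lambda_1+\frac{\lambda_{l+1}-\lambda_1}{1+\sum_{j=2}^{l}\frac{\lambda_{l+1}-\lambda_j}{\lambda_j-\lambda_1}\Bigl[1-(\lambda_j-\lambda_1)\sum_{\alpha=1}^{\min(j-1,n)}a_{\alpha j}^2\Bigr]}.$$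
   Context: $\Delta$ is the Laplacian of $\mathbf{R}^n$. The Dirichlet eigenvalues satisfy $0<\lambda_1<\lambda_2\le\lambda_3\le\cdots\nearrow\infty$, each repeated according to its finite multiplicity. The eigenfunction $u_j$ corresponds to $\lambda_j$: $\Delta u_j=-\lambda_ju_j$ in $\Omega$, $u_j=0$ on $\partial\Omega$, and $\int_\Omega u_ju_k=\delta_{jk}$; the family $\{u_j\}_{j\ge1}$ is an orthonormal basis of $L^2(\Omega)$. A Cartesian coordinate system $(z_1,\dots,z_n)$ means functions of the form $z_\alpha=\sum_{\gamma=1}^n q_{\alpha\gamma}x_\gamma-c_\alpha$, where $x_1,\dots,x_n$ are the standard coordinates, $(q_{\alpha\gamma})$ is an orthogonal matrix, and $c_\alpha\in\mathbf{R}$. Empty sums are zero. *)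

(* Defs.v *)
From HB Require Import structures.
From mathcomp Require Import all_boot all_order all_algebra.
From mathcomp Require Import all_classical all_reals all_analysis.

Set Implicit Arguments.
Unset Strict Implicit.
Unset Printing Implicit Defensive.

Import Order.TTheory GRing.Theory Num.Theory.
Import numFieldNormedType.Exports.

Local Open Scope classical_set_scope.
Local Open Scope ring_scope.

(* 'rV[R]_n carries the product (= Borel) sigma-algebra of R^n, generated by the
   coordinate functions; same construction as the library's for n.-tuple. *)
Definition rV_display : measure_display.
Proof. exact: default_measure_display. Qed.

Section measurable_rV.
Context {R : realType} (n : nat).

Definition coord_rV (i : 'I_n) (x : 'rV[R]_n) : measurableTypeR R := x ord0 i.

Let rV_set0 : g_sigma_preimage coord_rV set0.
Proof. exact: sigma_algebra0. Qed.

Let rV_setC A : g_sigma_preimage coord_rV A -> g_sigma_preimage coord_rV (~` A).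
Proof. exact: sigma_algebraC. Qed.

Let rV_bigcup (F : (set 'rV[R]_n)^nat) :
  (forall i, g_sigma_preimage coord_rV (F i)) ->
  g_sigma_preimage coord_rV (\bigcup_i (F i)).
Proof. exact: sigma_algebra_bigcup. Qed.

HB.instance Definition _ := @isMeasurable.Build rV_display
  'rV[R]_n (g_sigma_preimage coord_rV) rV_set0 rV_setC rV_bigcup.

End measurable_rV.

Section lebesgue_measure_rV.
Context {R : realType}.

Definition cons_rV n (p : measurableTypeR R * 'rV[R]_n) : 'rV[R]_n.+1 :=
  row_mx (p.1 : R)%:M p.2.

Lemma cons_rV0 n p : @cons_rV n p ord0 ord0 = p.1.
Proof.
rewrite /cons_rV; have -> : ord0 = lshift n (ord0 : 'I_1) :> 'I_n.+1.
  exact: val_inj.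
by rewrite (row_mxEl (p.1 : R)%:M) mxE eqxx mulr1n.
Qed.

Lemma cons_rVS n p i : @cons_rV n p ord0 (lift ord0 i) = p.2 ord0 i.
Proof.
rewrite /cons_rV; have -> : lift ord0 i = rshift 1 i :> 'I_n.+1.
  exact: val_inj.
by rewrite (row_mxEr (p.1 : R)%:M).
Qed.

Lemma cons_rV_split n (x : 'rV[R]_n.+1) :
  x = cons_rV (x ord0 ord0, \row_i x ord0 (lift ord0 i)).
Proof.
apply/rowP => i; case: (unliftP ord0 i) => [j ->|->].
  by rewrite cons_rVS mxE.
by rewrite cons_rV0.
Qed.

Lemma measurable_coord_rV n (i : 'I_n) :
  measurable_fun [set: 'rV[R]_n] (@coord_rV R n i).
Proof.
move=> _ Y mY; rewrite setTI; apply: sub_sigma_algebra => /=.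
rewrite -bigcup_seq/=; exists i => /=; first by rewrite mem_index_enum.
by exists Y => //; rewrite setTI.
Qed.

Lemma measurable_fun_rV d (T : measurableType d) n (f : T -> 'rV[R]_n) :
  (forall i, measurable_fun [set: T] (@coord_rV R n i \o f)) ->
  measurable_fun [set: T] f.
Proof.
move=> mf _ Y mY; rewrite setTI.
have : g_sigma_preimage (fun i => @coord_rV R n i \o f) `<=` measurable.
  apply: smallest_sub; first exact: sigma_algebra_measurable.
  rewrite -bigcup_seq/=; apply: bigcup_sub => i _ A [B mB <-].
  by apply: mf.
by rewrite g_sigma_preimage_comp; apply; exists Y => //; rewrite setTI.
Qed.

Lemma measurable_cons_rV n :
  measurable_fun [set: measurableTypeR R * 'rV[R]_n] (@cons_rV n).
Proof.
apply: measurable_fun_rV => i; case: (unliftP ord0 i) => [j ->|->].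
- have -> : coord_rV (lift ord0 j) \o @cons_rV n = coord_rV j \o snd.
    by apply/funext => p; rewrite /= /coord_rV cons_rVS.
  by apply: measurableT_comp => //; exact: measurable_coord_rV.
- have -> : coord_rV ord0 \o @cons_rV n = fst.
    by apply/funext => p; rewrite /= /coord_rV cons_rV0.
  exact: measurable_fst.
Qed.

Section step.
Local Open Scope ereal_scope.
Context n (mu : {sigma_finite_measure set 'rV[R]_n -> \bar R}).

Definition lebesgue_cons : set 'rV[R]_n.+1 -> \bar R :=
  pushforward (@lebesgue_measure R \x mu) (@cons_rV n).

Let lebesgue_cons0 : lebesgue_cons set0 = 0.
Proof. by rewrite /lebesgue_cons /pushforward preimage_set0 measure0. Qed.

Let lebesgue_cons_ge0 A : 0 <= lebesgue_cons A.
Proof. by rewrite /lebesgue_cons /pushforward measure_ge0. Qed.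

Let lebesgue_cons_sigma_additive : semi_sigma_additive lebesgue_cons.
Proof.
have mf := @measurable_cons_rV n.
move=> F mF tF mUF; rewrite /lebesgue_cons /pushforward preimage_bigcup.
apply: measure_semi_sigma_additive.
- by move=> k; rewrite -[X in measurable X]setTI; exact: mf.
- apply/trivIsetP => /= i j _ _ ij; rewrite -preimage_setI.
  by move/trivIsetP : tF => /(_ _ _ _ _ ij) ->//; rewrite preimage_set0.
- by rewrite -preimage_bigcup -[X in measurable X]setTI; exact: mf.
Qed.

HB.instance Definition _ := isMeasure.Build _ _ _ lebesgue_cons
  lebesgue_cons0 lebesgue_cons_ge0 lebesgue_cons_sigma_additive.

Let lebesgue_cons_sigma_finite : sigma_finite setT lebesgue_cons.
Proof.
have /sigma_finiteP[F [TF ndF Foo]] := sigma_finiteT (@lebesgue_measure R).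
have /sigma_finiteP[G [TG ndG Goo]] := sigma_finiteT mu.
pose g (x : 'rV[R]_n.+1) : measurableTypeR R * 'rV[R]_n :=
  (x ord0 ord0, (\row_i x ord0 (lift ord0 i))%R).
have gK : cancel (@cons_rV n) g.
  move=> [a v]; rewrite /g cons_rV0; congr pair.
  by apply/rowP => i; rewrite mxE cons_rVS.
have mg : measurable_fun setT g.
  apply: measurable_fun_pair => /=; first exact: measurable_coord_rV.
  apply: measurable_fun_rV => i.
  have -> : (coord_rV i \o (fun x : 'rV[R]_n.+1 => \row_j x ord0 (lift ord0 j)))%R
            = @coord_rV R _ (lift ord0 i).
    by apply/funext => x; rewrite /= /coord_rV mxE.
  exact: measurable_coord_rV.
exists (fun k => g @^-1` (F k `*` G k)).
  apply/esym; rewrite -subTset => x _.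
  have [i _ Fi] : (\bigcup_i F i) (g x).1 by rewrite -TF.
  have [j _ Gj] : (\bigcup_i G i) (g x).2 by rewrite -TG.
  exists (maxn i j) => //; split.
    by move: Fi; exact/subsetPset/ndF/leq_maxl.
  by move: Gj; exact/subsetPset/ndG/leq_maxr.
move=> k; have [mF Fkoo] := Foo k; have [mG Gkoo] := Goo k; split.
  by rewrite -[X in measurable X]setTI; apply: mg => //; exact: measurableX.
rewrite /lebesgue_cons /pushforward -comp_preimage.
have -> : g \o @cons_rV n = id by apply/funext => p /=; rewrite gK.
by rewrite product_measure1E// lte_mul_pinfty// ge0_fin_numE.
Qed.

HB.instance Definition _ := Measure_isSigmaFinite.Build _ _ _ lebesgue_cons
  lebesgue_cons_sigma_finite.

End step.

Fixpoint lebesgue_rV n : {sigma_finite_measure set 'rV[R]_n -> \bar R} :=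
  match n with
  | 0 => \d_ (0 : 'rV[R]_0)
  | n'.+1 => lebesgue_cons (lebesgue_rV n')
  end.

Lemma lebesgue_rV_box n (a b : 'rV[R]_n) : (forall i, a ord0 i <= b ord0 i) ->
  lebesgue_rV n [set x : 'rV[R]_n | forall i, a ord0 i <= x ord0 i <= b ord0 i] =
  (\prod_(i < n) (b ord0 i - a ord0 i))%:E.
Proof.
elim: n a b => [|n IH] a b ab.
  rewrite big_ord0 /= diracE mem_set //; by case.
rewrite big_ord_recl /= /lebesgue_cons /pushforward.
pose a' : 'rV[R]_n := \row_i a ord0 (lift ord0 i).
pose b' : 'rV[R]_n := \row_i b ord0 (lift ord0 i).
have -> : @cons_rV n @^-1` [set x | forall i, a ord0 i <= x ord0 i <= b ord0 i]
  = (`[a ord0 ord0, b ord0 ord0]%classic : set (measurableTypeR R)) `*`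
    [set x : 'rV[R]_n | forall i, a' ord0 i <= x ord0 i <= b' ord0 i].
  apply/seteqP; split => -[t v] /=.
    move=> H; split; first by have := H ord0; rewrite cons_rV0 /= in_itv.
    by move=> i; have := H (lift ord0 i); rewrite cons_rVS !mxE.
  move=> [H1 H2] i; case: (unliftP ord0 i) => [j ->|->].
    by have := H2 j; rewrite cons_rVS !mxE.
  by move: H1; rewrite cons_rV0 in_itv.
rewrite product_measure1E//; last first.
  have -> : [set x : 'rV[R]_n | forall i, a' ord0 i <= x ord0 i <= b' ord0 i] =
     \bigcap_(i in [set: 'I_n]) (coord_rV i @^-1` `[a' ord0 i, b' ord0 i]%classic).
    apply/seteqP; split => v /=.
      by move=> H i _ /=; rewrite in_itv; exact: H.
    by move=> H i; have := H i I; rewrite /= in_itv.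
  apply: fin_bigcap_measurable => // i _.
  rewrite -[X in measurable X]setTI; apply: measurable_coord_rV => //.
rewrite IH; last by move=> i; rewrite !mxE.
rewrite EFinM; congr (_ * _)%E; last first.
  by congr EFin; apply: eq_bigr => i _; rewrite !mxE.
rewrite [LHS]lebesgue_measure_itv /= lte_fin.
have := ab ord0; rewrite le_eqVlt => /orP[/eqP ->|->]; last by rewrite EFinB.
by rewrite ltxx subrr.
Qed.

End lebesgue_measure_rV.

Section domains.
Context {R : realType}.

Definition partial n (i : 'I_n) (f : 'rV[R]_n -> R) (x : 'rV[R]_n) : R :=
  'D_(delta_mx ord0 i : 'rV[R]_n) f x.

Definition laplacian n (f : 'rV[R]_n -> R) (x : 'rV[R]_n) : R :=
  \sum_(i < n) partial i (partial i f) x.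

(* f is C^k on the open set U: its iterated partial derivatives of order at
   most k exist and are continuous at every point of U. *)
Fixpoint class_C n (k : nat) (U : set 'rV[R]_n) (f : 'rV[R]_n -> R) : Prop :=
  (forall x, U x -> {for x, continuous f}) /\
  match k with
  | 0 => True
  | k'.+1 => forall i : 'I_n,
      (forall x, U x -> derivable f x (delta_mx ord0 i : 'rV[R]_n)) /\
      class_C k' U (partial i f)
  end.

Definition smooth_on n (U : set 'rV[R]_n) (f : 'rV[R]_n -> R) : Prop :=
  forall k, class_C k U f.

Definition closed_cube m : set 'rV[R]_m :=
  [set t | forall i, 0 <= t ord0 i <= 1].

Definition open_cube m : set 'rV[R]_m :=
  [set t | forall i, 0 < t ord0 i < 1].

(* A smooth m-dimensional piece of R^n: the image of the closed unit m-cube under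
   a map which is C^oo near the cube and an injective immersion inside it.
   Nothing is required on the faces of the cube, so that pieces such as a sector
   of a cone or an arc with a cusp at its end are allowed.
   For m = 0 a piece is a point. *)
Definition smooth_piece m n (S : set 'rV[R]_n) : Prop :=
  exists (U : set 'rV[R]_m) (phi : 'rV[R]_m -> 'rV[R]_n),
    [/\ open U /\ @closed_cube m `<=` U,
        forall j : 'I_n, smooth_on U (fun t => phi t ord0 j),
        forall s t, open_cube s -> open_cube t -> phi s = phi t -> s = t,
        forall t, open_cube t -> row_free ('J phi t)
      & S = phi @` @closed_cube m].

Definition boundary n (A : set 'rV[R]_n) : set 'rV[R]_n :=
  closure A `\` A°.

Definition piecewise_smooth_boundary n (A : set 'rV[R]_n) : Prop :=
  exists (N : nat) (S : 'I_N -> set 'rV[R]_n),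
    (forall i, smooth_piece n.-1 (S i)) /\ boundary A = \bigcup_i S i.

Definition domain n (A : set 'rV[R]_n) : Prop :=
  [/\ open A, connected A & A !=set0].

End domains.

Section dirichlet.
Context {R : realType} (n : nat) (Omega : set 'rV[R]_n).

Definition integral_on (f : 'rV[R]_n -> R) : R :=
  \int[lebesgue_rV n]_(x in Omega) f x.

Definition square_integrable (f : 'rV[R]_n -> R) : Prop :=
  measurable_fun Omega f /\
  (lebesgue_rV n).-integrable Omega (fun x => (f x ^+ 2)%:E).

Definition dirichlet_eigenfunction (lambda : R) (u : 'rV[R]_n -> R) : Prop :=
  [/\ class_C 2 Omega u,
      {within closure Omega, continuous u},
      forall x, Omega x -> laplacian u x = - lambda * u x,
      forall x, boundary Omega x -> u x = 0
    & exists2 x, Omega x & u x != 0].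

(* Sequences are indexed by the positive integers; the term of index 0 is never
   used. *)
Definition orthonormal_basis_L2 (u : nat -> 'rV[R]_n -> R) : Prop :=
  [/\ forall j, (0 < j)%N -> square_integrable (u j),
      forall j k, (0 < j)%N -> (0 < k)%N ->
        integral_on (fun x => u j x * u k x) = (j == k)%:R
    & forall f, square_integrable f ->
        (fun N : nat => integral_on (fun x =>
           (f x - \sum_(1 <= j < N.+1)
                    integral_on (fun y => f y * u j y) * u j x) ^+ 2))
        @ \oo --> (0 : R)].

(* Since (u j) is an orthonormal basis of L^2(Omega), the sequence lambda lists
   all the eigenvalues, each as often as its multiplicity. *)
Record dirichlet_spectrum (lambda : nat -> R) (u : nat -> 'rV[R]_n -> R)
    : Prop := DirichletSpectrum {
  lambda1_gt0 : 0 < lambda 1 ;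
  lambda1_lt2 : lambda 1 < lambda 2 ;
  lambda_nondecreasing : forall j, (2 <= j)%N -> lambda j <= lambda j.+1 ;
  lambda_cvgy : lambda @ \oo --> +oo ;
  dirichletP : forall j, (0 < j)%N -> dirichlet_eigenfunction (lambda j) (u j) ;
  dirichlet_basis : orthonormal_basis_L2 u
}.

End dirichlet.

Section bound.
Context {R : realType} (n : nat).

Definition cartesian_coordinates (z : 'I_n -> 'rV[R]_n -> R) : Prop :=
  exists (q : 'M[R]_n) (c : 'I_n -> R), q *m q^T = 1%:M /\
    forall alpha x,
      z alpha x = \sum_(gamma < n) q alpha gamma * x ord0 gamma - c alpha.

(* The ordinal alpha : 'I_n stands for the 1-based index alpha.+1, hence
   the shifts alpha.+1 and alpha.+2 below. *)
Definition coord_coef (Omega : set 'rV[R]_n) (u : nat -> 'rV[R]_n -> R)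
    (z : 'I_n -> 'rV[R]_n -> R) (alpha : 'I_n) (j : nat) : R :=
  integral_on Omega (fun x => z alpha x * u 1%N x * u j x).

Definition sigma_coef (lambda : nat -> R) (a : 'I_n -> nat -> R) (l : nat) : R :=
  lambda 1 + (lambda l.+1 - lambda 1) /
    (1 + \sum_(2 <= j < l.+1)
           (lambda l.+1 - lambda j) / (lambda j - lambda 1) *
           (1 - (lambda j - lambda 1) *
              \sum_(alpha < n | (alpha.+1 <= minn j.-1 n)%N) a alpha j ^+ 2)).

Definition gap_sum (lambda : nat -> R) (a : 'I_n -> nat -> R) (k : nat) : R :=
  \sum_(alpha < n)
    (lambda k.+1 - lambda 1) /
    (1 + \sum_(alpha.+2 <= j < k.+1) (lambda k.+1 - lambda j) * a alpha j ^+ 2).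

End bound.

(* Main.v *)
Require Import Defs.
From mathcomp Require Import all_boot all_order all_algebra.
From mathcomp Require Import all_classical all_reals all_analysis.
From mathcomp Require Import measurable_realfun.
From mathcomp Require Import zify ring lra.
Set Implicit Arguments.
Unset Strict Implicit.
Unset Printing Implicit Defensive.
Import Order.TTheory GRing.Theory Num.Theory.
Import numFieldNormedType.Exports.
Local Open Scope classical_set_scope.
Local Open Scope ring_scope.

(** Let u be the first eigenfunction, lambda its eigenvalue, and D(f, g) the
    integral of grad f . grad g - lambda f g. The form D is positive on the
    functions that vanish on the boundary, because lambda is the lowest
    eigenvalue. Integrating by parts, D(x_i u, g) is -2 times the integral of
    g d_i u, whence D(x_i u, x_k u) = delta_ik: in every Cartesian system the
    functions Z_i = z_i u are orthonormal for D.

    Left-hand side. For G orthogonal to u, the expansion of G in eigenfunctions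
    gives
      (lambda_(k+1) - lambda) |G|^2
        <= D(G, G) + sum_(2 <= j <= k) (lambda_(k+1) - lambda_j) <G, u_j>^2
    ([defect_gap]). The origin is put at the barycentre of u^2, so that Z_i is
    orthogonal to u, and the axes are rotated so that the matrix of the
    <x_i u, u_(j+1)> becomes upper triangular ([adapted_coordinates]). Then
    D(Z_i, Z_i) = 1 and the coefficients of Z_i on u_2, ..., u_i vanish, so that
    the i-th term of the sum is at most 1 / |Z_i|^2 ([coordinate_gap]).

    Right-hand side. Let d_i be the derivative along the axis of z_i. By
    Cauchy-Schwarz, 1 / |Z_i|^2 <= |d_i phi|^2 / <Z_i, d_i phi>^2 for every test
    function phi. For phi = u |u|^r all these integrals are explicit in
    m = <phi, u> and M = |phi|^2, and the sum over i is at most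
    (r + 2)^2 / (2 r + 1) lambda M / m^2 ([sum_inverse_moment]).
    It remains to bound M / m^2. The function G = phi - m u is orthogonal to u,
    and D(G, Z_i) = 0 for all i because phi d_i u is a derivative. The
    coefficients <G, u_j> are therefore controlled by the part of u_j that is
    D-orthogonal to all the Z_i, which turns the inequality displayed above into
    (sigma_l - lambda) |G|^2 <= D(G, G) ([sigma_gap]). This is an upper bound for
    M / m^2, and for r = (sigma_l - lambda) / (sigma_l + lambda) the final
    estimate is exactly 3 lambda + lambda^2 / sigma_l ([optimal_exponent]).

    Analysis. An eigenfunction is C^2 inside the domain and continuous up to the
    boundary, but its gradient may be unbounded. All the identities above follow
    from [integral_partial0], the integral of d_i G is 0 when G vanishes on the
    boundary, and from [green_first_identity]. Both are proved first with G
    replaced by a function of G that vanishes as soon as G is small: everything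
    then has compact support in the domain, and Fubini with the fundamental
    theorem of calculus suffices. The passage to the limit is legitimate because
    d_i G = 0 almost everywhere on the zero set of G ([simple_zeros_null]). *)

(** * Borel sets and continuous functions *)

Section borel_rV.
Context {R : realType}.

Lemma ball_rVP n (x y : 'rV[R]_n) (e : R) : 0 < e ->
  ball x e y <-> forall i, `|x ord0 i - y ord0 i| < e.
Proof.
move=> e0; rewrite /ball /=; split => [[_ H] i|H]; first exact: H.
by split => // i j; rewrite (ord1 i); exact: H.
Qed.

Lemma measurable_ball_rV n (x : 'rV[R]_n) (e : R) : 0 < e ->
  measurable (ball x e : set 'rV[R]_n).
Proof.
move=> e0.
have -> : ball x e =
    \bigcap_(i in [set: 'I_n]) (@coord_rV R n i @^-1` (ball (x ord0 i) e : set R)).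
  apply/seteqP; split => y.
    by move=> /(ball_rVP _ _ e0) H i _; exact: H.
  by move=> H; apply/(ball_rVP _ _ e0) => i; exact: (H i I).
apply: fin_bigcap_measurable => // i _.
rewrite -[X in measurable X]setTI; apply: measurable_coord_rV => //.
exact: measurable_ball.
Qed.

(** Rational balls of radius 1/(k+1) form a countable base, and each of them is
    a finite intersection of preimages of intervals. *)
Lemma open_measurable_rV n (U : set 'rV[R]_n) : open U -> measurable U.
Proof.
move=> oU.
pose B (p : 'rV[rat]_n * nat) : set 'rV[R]_n :=
  ball (\row_i ratr (p.1 ord0 i) : 'rV[R]_n) p.2.+1%:R^-1.
have -> : U = \bigcup_p (if pselect (B p `<=` U) is left _ then B p else set0).
  apply/seteqP; split => [x Ux|x [p _]]; last first.
    by case: pselect => // BU; exact: BU.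
  have /nbhs_ballP[e /= e0 eU] : nbhs x U by exact: open_nbhs_nbhs.
  have [k ke] : exists k : nat, 2 * k.+1%:R^-1 < e.
    have [k hk] := ltr_add_invr (divr_gt0 e0 (ltr0Sn R 1)).
    by exists k; rewrite mulrC -ltr_pdivlMr// -[ltLHS]add0r.
  have k0 : 0 < k.+1%:R^-1 :> R by rewrite invr_gt0.
  have /choice[q qP] (i : 'I_n) : exists q : rat, `|ratr q - x ord0 i| < k.+1%:R^-1.
    have : x ord0 i < x ord0 i + k.+1%:R^-1 by rewrite ltrDl.
    move=> /rat_in_itvoo[q]; rewrite in_itv/= => /andP[h1 h2]; exists q.
    by rewrite gtr0_norm ?subr_gt0// ltrBlDl.
  exists (\row_i q i, k) => //=.
  case: pselect => [_|]; last first.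
    case; apply: subset_trans eU => y /(ball_rVP _ _ k0) H.
    apply/(ball_rVP _ _ e0) => i; apply: le_lt_trans ke.
    rewrite mulr_natl mulr2n; have := H i; have := qP i; rewrite !mxE.
    move=> /ltW h1 /ltW h2; rewrite -(subrKA (ratr (q i))).
    by apply: le_trans (ler_normD _ _) _; rewrite lerD// distrC.
  by apply/(ball_rVP _ _ k0) => i; rewrite !mxE.
apply: countable_bigcupT_measurable; first exact: countableP.
move=> p; case: pselect => // _.
by apply: measurable_ball_rV; rewrite invr_gt0.
Qed.

Lemma open_continuous_measurable_rV n (U : set 'rV[R]_n) (f : 'rV[R]_n -> R) :
  open U -> (forall x, U x -> {for x, continuous f}) -> measurable_fun U f.
Proof.
move=> oU cf; apply: (measurability _ (RGenOInfty.measurableE R)).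
move=> _ [_ [a ->] <-]; apply: open_measurable_rV.
rewrite openE => x [Ux fx]; apply: filterI; first exact: open_nbhs_nbhs.
apply: (cf _ Ux); apply: open_nbhs_nbhs; split => //; exact: open_gt.
Qed.

Lemma continuous_measurable_rV n (f : 'rV[R]_n -> R) : continuous f ->
  measurable_fun setT f.
Proof. by move=> cf; apply: (open_continuous_measurable_rV openT) => x _; exact: cf. Qed.

End borel_rV.

(** * Fubini along coordinate lines *)

Lemma bounded_support_integrable d (T : measurableType d) (R : realType)
    (mu : {measure set T -> \bar R}) (A : set T) (g : T -> R) (C : R) :
  measurable A -> (mu A < +oo)%E -> measurable_fun setT g ->
  (forall x, `|g x| <= C) -> (forall x, ~ A x -> g x = 0) ->
  mu.-integrable setT (EFin \o g).
Proof.
move=> mA Afin mg gC g0.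
have gA : g = g \_ A.
  apply/funext => x; rewrite /patch; case: ifPn => // /negP xA.
  by apply: g0 => Ax; apply: xA; rewrite inE.
rewrite gA -restrict_EFin; apply/integrable_restrict => //; rewrite setTI.
apply: measurable_bounded_integrable => //; first exact: measurable_funTS.
exists C; split; first exact: num_real.
by move=> M CM x _ /=; rewrite (le_trans (gC x))// ltW.
Qed.

Section slices.
Context {R : realType}.

Definition box n (B : R) : set 'rV[R]_n := [set x | forall i, `|x ord0 i| <= B].
Arguments box : clear implicits.

Lemma lebesgue_box n (B : R) : 0 <= B ->
  measurable (box n B) /\ (lebesgue_rV n (box n B) < +oo)%E.
Proof.
move=> B0; split.
  have -> : box n B = \bigcap_(i in [set: 'I_n])
      (@coord_rV R n i @^-1` (`[- B, B]%classic : set R)).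
    apply/seteqP; split => y.
      by move=> H i _; rewrite /= in_itv/= -ler_norml; exact: H.
    by move=> H i; have := H i I; rewrite /= in_itv/= -ler_norml.
  apply: fin_bigcap_measurable => // i _.
  by rewrite -[X in measurable X]setTI; apply: measurable_coord_rV.
have -> : box n B = [set x : 'rV[R]_n | forall i,
    (const_mx (- B) : 'rV[R]_n) ord0 i <= x ord0 i <= (const_mx B : 'rV[R]_n) ord0 i].
  by apply/seteqP; split => x /= H i; have := H i; rewrite !mxE -ler_norml.
rewrite lebesgue_rV_box ?ltry// => i; rewrite !mxE.
by rewrite (le_trans _ B0)// oppr_le0.
Qed.

Lemma cons_rV_line0 n (t : R) (v : 'rV[R]_n) :
  cons_rV (t, v) = t *: delta_mx ord0 ord0 + cons_rV (0, v).
Proof.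
apply/rowP => i; case: (unliftP ord0 i) => [j ->|->].
  rewrite [RHS]mxE !cons_rVS [X in _ = X + _]mxE [X in _ = _ * X + _]mxE.
  by rewrite /= mulr0 add0r.
rewrite [RHS]mxE !cons_rV0 [X in _ = X + _]mxE [X in _ = _ * X + _]mxE.
by rewrite !eqxx mulr1 addr0.
Qed.

Lemma cons_rV_line n (t s : R) (v : 'rV[R]_n) j :
  cons_rV (t, s *: delta_mx ord0 j + v) =
  s *: delta_mx ord0 (lift ord0 j) + cons_rV (t, v).
Proof.
apply/rowP => i; case: (unliftP ord0 i) => [k ->|->].
  rewrite [RHS]mxE !cons_rVS /= [LHS]mxE [X in X + _ = _]mxE.
  rewrite [X in _ * X + _ = _]mxE [X in _ = X + _]mxE [X in _ = _ * X + _]mxE.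
  by rewrite (inj_eq (@lift_inj _ ord0)).
rewrite [RHS]mxE !cons_rV0 [X in _ = X + _]mxE [X in _ = _ * X + _]mxE.
by rewrite /= mulr0 add0r.
Qed.

(** Fubini: boundedness and bounded support pass to every slice, so the
    induction on the dimension never meets a non-integrable slice. *)
Lemma line_integral0 n (i : 'I_n) (g : 'rV[R]_n -> R) (B C : R) :
  0 <= B -> measurable_fun setT g -> (forall x, `|g x| <= C) ->
  (forall x, ~ box n B x -> g x = 0) ->
  (forall x, \int[lebesgue_measure]_t
     (g (t *: (delta_mx ord0 i : 'rV[R]_n) + x))%:E = 0)%E ->
  (\int[lebesgue_rV n]_x (g x)%:E = 0)%E.
Proof.
move=> B0; elim: n i g => [[]//|n IH] i g mg gC gB line0.
have [mbox fbox] := lebesgue_box n.+1 B0.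
have mc := @measurable_cons_rV R n.
have mgc : measurable_fun setT (g \o @cons_rV R n) by exact: measurableT_comp.
pose mu := (@lebesgue_measure R \x lebesgue_rV n)%E.
have intc : mu.-integrable setT (EFin \o (g \o @cons_rV R n)).
  apply: (@bounded_support_integrable _ _ _ mu (@cons_rV R n @^-1` box n.+1 B) _ C) => //.
  - by rewrite -[X in measurable X]setTI; exact: mc.
  - by move=> x; exact: gC.
  - by move=> x; exact: gB.
rewrite [LHS](@integral_pushforward _ _ _ _ _ _ mc mu setT (EFin \o g)) //; last first.
  exact/measurable_EFinP.
rewrite preimage_setT.
case: (unliftP ord0 i) => [j ij|i0].
- rewrite -(integral12_prod_meas1 intc) -[RHS](@integral0 _ _ _ (@lebesgue_measure R) setT).
  apply: eq_integral => t _; rewrite /fubini_F /=.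
  apply: (IH j (fun v => g (cons_rV (t, v)))).
  + apply: (measurableT_comp mg); apply: (measurableT_comp mc).
    exact: pair1_measurable.
  + by move=> v; exact: gC.
  + move=> v vB; apply: gB => H; apply: vB => k.
    by have := H (lift ord0 k); rewrite cons_rVS.
  + move=> v; rewrite -[RHS](line0 (cons_rV (t, v))); apply: eq_integral => s _.
    by rewrite cons_rV_line ij.
- rewrite -(integral21_prod_meas1 intc) -[RHS](@integral0 _ _ _ (lebesgue_rV n) setT).
  apply: eq_integral => v _; rewrite /fubini_G /= -[RHS](line0 (cons_rV (0, v))).
  by apply: eq_integral => t _; rewrite cons_rV_line0 i0.
Qed.

End slices.
Arguments box {R} n B _.

(** * Partial derivatives with compact support *)

Section lines.
Context {R : realType} (n : nat).
Implicit Types (v x : 'rV[R]_n) (g : 'rV[R]_n -> R).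

Lemma line_continuous v x : continuous (fun t : R => t *: v + x).
Proof.
move=> t; apply: cvgD; last exact: cvg_cst.
by apply: cvgZr_tmp => //; exact: cvg_id.
Qed.

Lemma is_derive_line g v x (t d : R) :
  is_derive (t *: v + x) v g d -> is_derive t 1 (fun s : R => g (s *: v + x)) d.
Proof.
have E : (fun h : R => h^-1 *: (g (h *: v + (t *: v + x)) - g (t *: v + x)))
    = (fun h : R => h^-1 *: (g ((h *: (1 : R) + t) *: v + x) - g (t *: v + x))).
  by apply/funext => h; rewrite [h *: 1]mulr1 scalerDl addrA.
move=> [dg gd]; split.
  by move: dg; rewrite /derivable /= E.
by move: gd; rewrite /derive /= E.
Qed.

End lines.

Section compact_support.
Context {R : realType} (n : nat).
Implicit Types (g : 'rV[R]_n -> R).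

Lemma box_compact (B : R) : compact (box n B).
Proof.
have -> : box n B = [set v : 'rV[R]_n | forall i, (`[- B, B]%classic : set R) (v ord0 i)].
  by apply/seteqP; split => x /= H i; have := H i; rewrite in_itv/= ler_norml.
by apply: (@rV_compact R n (fun=> `[- B, B]%classic)) => _; exact: segment_compact.
Qed.

Lemma continuous_box_bounded g (B : R) : continuous g ->
  (forall x, ~ box n B x -> g x = 0) -> exists C, forall x, `|g x| <= C.
Proof.
move=> cg g0.
have /compact_bounded[M [_ MP]] : compact (g @` box n B).
  apply: continuous_compact; last exact: box_compact.
  exact: continuous_subspaceT.
exists (`|M| + 1) => x; have [Bx|/g0->] := pselect (box n B x); last first.
  by rewrite normr0 addr_ge0.
by apply: MP; [rewrite ltr_pwDr// ler_norm|exists x].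
Qed.

(** On each line in the i-th direction, the fundamental theorem of calculus
    applies between two points that lie outside of the box. *)
Lemma integral_partial_compact g g' (i : 'I_n) (B : R) : 0 <= B ->
  (forall x, is_derive x (delta_mx ord0 i : 'rV[R]_n) g (g' x)) ->
  continuous g' ->
  (forall x, ~ box n B x -> g x = 0) -> (forall x, ~ box n B x -> g' x = 0) ->
  (\int[lebesgue_rV n]_x (g' x)%:E = 0)%E.
Proof.
move=> B0 dg cg' gB g'B.
have [C g'C] := continuous_box_bounded cg' g'B.
apply: (line_integral0 (i := i) B0 _ g'C g'B); first exact: continuous_measurable_rV.
move=> x; set e : 'rV[R]_n := delta_mx ord0 i.
(* at the parameters L and - L the line through x is outside of the box *)
pose L := B + `|x ord0 i| + 1.
have L0 : 0 < L by rewrite ltr_pwDr// addr_ge0.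
have out t : L <= `|t| -> ~ box n B (t *: e + x).
  move=> Lt /(_ i); rewrite !mxE !eqxx mulr1 => H.
  have : `|t| <= `|t + x ord0 i| + `|x ord0 i|.
    by rewrite -{1}(addrK (x ord0 i) t) ler_normB.
  move=> /(le_trans Lt); rewrite leNgt => /negP; apply.
  by rewrite (le_lt_trans (lerD H (lexx _)))// ltr_pwDr.
rewrite -(setTI setT) integral_mkcondr/=.
have -> : (fun t : R => (g' (t *: e + x))%:E) \_ setT =
          (fun t : R => (g' (t *: e + x))%:E) \_ `[- L, L].
  apply/funext => t; rewrite /patch in_setT; case: ifPn => // /negP tL.
  congr EFin; apply/g'B/out; rewrite leNgt; apply/negP => tL'; apply: tL.
  by rewrite inE/= in_itv/= -ler_norml ltW.
rewrite -integral_mkcondr setTI.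
have dh t := is_derive_line (dg (t *: e + x)).
rewrite (@continuous_FTC2 R _ (fun t => g (t *: e + x))).
- rewrite !gB ?sube0//; apply: out; rewrite ?normrN gtr0_norm//.
- by rewrite gtrN.
- apply: continuous_subspaceT => t.
  by apply: continuous_comp; [exact: line_continuous|exact: cg'].
- have ch t : {for t, continuous (fun t : R => g (t *: e + x) : R)}.
    by apply: differentiable_continuous; apply/derivable1_diffP; case: (dh t).
  split.
  + by move=> t _; case: (dh t).
  + by apply: cvg_at_right_filter; exact: ch.
  + by apply: cvg_at_left_filter; exact: ch.
- by move=> t _; rewrite derive1E; case: (dh t).
Qed.

End compact_support.

(** * Zeros with a nonzero partial derivative *)

Section null_set.
Context {R : realType}.

Lemma countable_isolated (A : set R) :
  (forall t, A t -> exists2 e : R, 0 < e &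
     forall s, A s -> `|s - t| < e -> s = t) -> countable A.
Proof.
move=> isoA.
have /choice[F FP] (t : R) : exists pq : rat * rat, A t ->
    ratr pq.1 < t < ratr pq.2 /\
    (forall s, A s -> ratr pq.1 < s < ratr pq.2 -> s = t).
  have [/isoA[e e0 eA]|nA] := pselect (A t); last by exists (0, 0).
  have : t - e < t by rewrite gtrBl.
  move=> /rat_in_itvoo[p]; rewrite in_itv/= => /andP[p1 p2].
  have : t < t + e by rewrite ltrDl.
  move=> /rat_in_itvoo[q]; rewrite in_itv/= => /andP[q1 q2].
  exists (p, q) => _; split; first by rewrite /= p2 q1.
  move=> s As /= /andP[s1 s2]; apply: eA => //.
  by rewrite ltr_distl (lt_trans p1 s1) (lt_trans s2 q2).
apply/countable_injP; exists (pickle \o F) => s t; rewrite !inE => As At /=.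
move=> /(pcan_inj (@pickleK _)) FE.
by have [h _] := FP _ As; have [_ +] := FP _ At; apply => //; rewrite -FE.
Qed.

Lemma simple_zero_isolated (h : R -> R) (t d : R) :
  is_derive t 1 h d -> d != 0 -> h t = 0 ->
  exists2 e : R, 0 < e & forall s, h s = 0 -> `|s - t| < e -> s = t.
Proof.
move=> [dh hd] d0 ht.
have : (fun s : R => s^-1 *: (h (s *: (1 : R) + t) - h t)) @ 0^' --> 'D_1 h t by [].
rewrite hd => /cvgr_neq0 /(_ d0) /nbhs_ballP[e /= e0 eP].
exists e => // s hs st; apply/eqP; rewrite -subr_eq0; apply/negPn/negP => st0.
have := eP (s - t); rewrite /ball/= sub0r normrN => /(_ st st0).
by rewrite [_ *: 1]mulr1 subrK ht hs subrr scaler0 eqxx.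
Qed.

(** A line in the i-th direction meets the set in simple zeros only; those are
    isolated, hence countable, and Fubini concludes. *)
Lemma simple_zeros_null n (i : 'I_n) (U : set 'rV[R]_n) (B : R)
    (G : 'rV[R]_n -> R) :
  open U -> 0 <= B -> U `<=` box n B ->
  (forall x, U x -> {for x, continuous G}) ->
  (forall x, U x -> derivable G x (delta_mx ord0 i : 'rV[R]_n)) ->
  (forall x, U x -> {for x, continuous (partial i G)}) ->
  let Z := [set x | [/\ U x, G x = 0 & partial i G x <> 0]] in
  measurable Z /\ lebesgue_rV n Z = 0%E.
Proof.
move=> oU B0 UB cG dG cdG Z.
have mZ : measurable Z.
  have -> : Z = (U `&` G @^-1` [set 0]) `&` (U `&` partial i G @^-1` (~` [set 0])).
    by apply/seteqP; split => [x [Ux Gx dGx]|x [[Ux Gx] [_ dGx]]]; do ?split.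
  have mU := open_measurable_rV oU.
  apply: measurableI.
    exact: (open_continuous_measurable_rV oU cG).
  by apply: (open_continuous_measurable_rV oU cdG) => //; exact: measurableC.
split => //.
rewrite -[Z]setIT -integral_indic//.
apply: (@line_integral0 _ _ i (\1_Z) B 1) => //.
- by move=> x; rewrite indicE; case: (_ \in _); rewrite ?normr0 ?normr1.
- move=> x xB; rewrite indicE memNset// => -[Ux _ _]; exact/xB/UB.
- move=> x; set e : 'rV[R]_n := delta_mx ord0 i.
  pose A : set R := [set t | Z (t *: e + x)].
  have cA : countable A.
    apply: countable_isolated => t [Ut Gt dGt].
    have dh := is_derive_line (derivableP (dG _ Ut)).
    have [r r0 rP] := simple_zero_isolated dh (introN eqP dGt) Gt.
    by exists r => // s [_ Gs _]; exact: rP.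
  transitivity (\int[lebesgue_measure]_t (\1_A t)%:E)%E.
    by apply: eq_integral => t _; rewrite !indicE.
  rewrite integral_indic//; last exact: countable_measurable.
  by rewrite setIT; exact: countable_lebesgue_measure0.
Qed.

End null_set.

(** * Extension by zero across the boundary *)

Section extension.
Context {R : realType} (n : nat) (Om : set 'rV[R]_n) (B : R).
Hypotheses (oOm : open Om) (B0 : 0 <= B) (OmB : Om `<=` box n B).
Implicit Types (G K : 'rV[R]_n -> R).

Definition vanishing G : Prop :=
  {within closure Om, continuous G} /\ forall x, boundary Om x -> G x = 0.

(** Outside of Om a point is either on the boundary, where G is continuous with
    value 0, or in the exterior, where there is nothing to prove. *)
Lemma vanishing_near G (e : R) x : vanishing G -> 0 < e -> ~ Om x ->
  \forall y \near x, Om y -> `|G y| < e.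
Proof.
move=> [/subspace_continuousP cG G0] e0 nOm.
have [cx|ncx] := pselect (closure Om x); last first.
  have : nbhs x (~` closure Om).
    apply: open_nbhs_nbhs; split => //.
    by rewrite openC; exact: closed_closure.
  by apply: filterS => y ny /(@subset_closure _ Om y).
have Gx : G x = 0.
  by apply: G0; split => // /interior_subset.
have : G y @[y --> within (closure Om) (nbhs x)] --> (0 : R).
  by rewrite -[X in _ --> X]Gx; exact: cG.
move=> /cvgr0Pnorm_lt /(_ _ e0).
rewrite near_withinE; apply: filterS => y + Oy; apply.
exact: subset_closure.
Qed.

Section level.
Context (G : 'rV[R]_n -> R) (e : R).
Hypotheses (vG : vanishing G) (e0 : 0 < e).

(** Since G vanishes on the boundary, this condition keeps K away from it; the
    extension of K by 0 is then as regular on the whole space as K is on Om. *)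
Definition cut_off K := forall x, Om x -> `|G x| <= e -> K x = 0.

Lemma ext0_near K x : cut_off K -> ~ Om x -> \forall y \near x, 0 = (K \_ Om) y.
Proof.
move=> K0 nOm; apply: filterS (vanishing_near vG e0 nOm) => y Ge.
by rewrite /patch; case: ifPn => //; rewrite inE => Oy; rewrite K0// ltW// Ge.
Qed.

Lemma ext_near K x : Om x -> \forall y \near x, K y = (K \_ Om) y.
Proof.
move=> Ox; have : nbhs x Om by exact: open_nbhs_nbhs.
by apply: filterS => y Oy; rewrite /patch mem_set.
Qed.

Lemma continuous_ext K : cut_off K ->
  (forall x, Om x -> {for x, continuous K}) -> continuous (K \_ Om).
Proof.
move=> K0 cK x; have [Ox|nOx] := pselect (Om x).
  rewrite /continuous_at {2}/patch mem_set//.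
  have cKx : K y @[y --> x] --> K x by exact: cK.
  exact: (cvg_trans (near_eq_cvg (ext_near K Ox)) cKx).
rewrite /continuous_at {2}/patch memNset//.
have c0 : (cst 0 : 'rV[R]_n -> R) y @[y --> x] --> (0 : R) by exact: cst_continuous.
exact: (cvg_trans (@near_eq_cvg _ _ (nbhs x) _ (fun=> 0 : R) (K \_ Om) (ext0_near K0 nOx)) c0).
Qed.

Lemma is_derive_ext K K' x (v : 'rV[R]_n) : cut_off K ->
  (forall x, Om x -> is_derive x v K (K' x)) ->
  is_derive x v (K \_ Om) ((K' \_ Om) x).
Proof.
move=> K0 dK; have [Ox|nOx] := pselect (Om x).
  rewrite {2}/patch mem_set//; apply: near_eq_is_derive (dK x Ox).
  exact: ext_near.
rewrite {2}/patch memNset//.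
apply: (near_eq_is_derive (f := cst 0)); first exact: ext0_near.
Qed.

Lemma measurable_dom : measurable Om. Proof. exact: open_measurable_rV. Qed.

Lemma lebesgue_dom : (lebesgue_rV n Om < +oo)%E.
Proof.
have [mb fb] := lebesgue_box n B0; apply: le_lt_trans fb.
by apply: le_measure; rewrite ?inE//; exact: measurable_dom.
Qed.

Lemma ext_bounded K : cut_off K -> (forall x, Om x -> {for x, continuous K}) ->
  exists C, forall x, Om x -> `|K x| <= C.
Proof.
move=> K0 cK; have [|C CP] := continuous_box_bounded (B := B) (continuous_ext K0 cK).
  by move=> x xB; rewrite /patch memNset// => /OmB.
by exists C => x Ox; have := CP x; rewrite /patch mem_set.
Qed.

Lemma bounded_integrable K (C : R) : (forall x, Om x -> {for x, continuous K}) ->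
  (forall x, Om x -> `|K x| <= C) ->
  (lebesgue_rV n).-integrable Om (EFin \o K).
Proof.
move=> cK KC; apply: measurable_bounded_integrable.
- exact: measurable_dom.
- exact: lebesgue_dom.
- exact: open_continuous_measurable_rV.
- exists C; split; first exact: num_real.
  by move=> M CM x Ox /=; rewrite (le_trans (KC x Ox))// ltW.
Qed.

Lemma cut_off_integrable K : cut_off K ->
  (forall x, Om x -> {for x, continuous K}) ->
  (lebesgue_rV n).-integrable Om (EFin \o K).
Proof.
by move=> K0 cK; have [C] := ext_bounded K0 cK; exact: bounded_integrable.
Qed.

Lemma integral_cut_off_partial K K' (i : 'I_n) : cut_off K -> cut_off K' ->
  (forall x, Om x -> is_derive x (delta_mx ord0 i : 'rV[R]_n) K (K' x)) ->
  (forall x, Om x -> {for x, continuous K'}) ->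
  \int[lebesgue_rV n]_(x in Om) K' x = 0.
Proof.
move=> K0 K'0 dK cK'; rewrite Rintegral_mkcond /Rintegral.
have out H x : ~ box n B x -> (H \_ Om : _ -> R) x = 0.
  by move=> xB; rewrite /patch memNset// => /OmB.
have dext x := @is_derive_ext K K' x (delta_mx ord0 i) K0 dK.
by rewrite (integral_partial_compact B0 dext (continuous_ext K'0 cK') (out K) (out K')).
Qed.

End level.
End extension.

(** * Soft cut-offs and signed powers of a real variable *)

Section one_variable.
Context {R : realType}.
Implicit Types (e s r : R).

Lemma is_derive_slope0 (f k : R -> R) (a : R) : k x @[x --> a] --> (0 : R) ->
  (forall x, `|f x - f a| <= k x * `|x - a|) -> is_derive a 1 f 0.
Proof.
move=> k0 fk.
have cv : (fun h : R => h^-1 *: (f (h *: (1 : R) + a) - f a)) @ 0^' --> (0 : R).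
  apply/cvgr0Pnorm_lt => e e0.
  have : \forall x \near a, `|k x| < e by move/cvgr0Pnorm_lt : k0; exact.
  move=> /nbhs_ballP[d /= d0 dP]; apply/nbhs_ballP; exists d => //= h hd h0.
  rewrite [h *: 1]mulr1; have /dP ka : ball a d (h + a).
    by rewrite /ball/= opprD addrCA subrr addr0; move: hd; rewrite /ball/= sub0r.
  rewrite /= in ka; apply: le_lt_trans ka; rewrite normrM normfV.
  rewrite ler_pdivrMl ?normr_gt0// mulrC.
  apply: le_trans (fk _) _; by rewrite addrK ler_wpM2r// ler_norm //.
apply: DeriveDef; last exact/cvg_lim.
by apply/cvg_ex; exists 0.
Qed.

(** A C^1 approximation of the identity that vanishes near 0. For this formula
    the derivative is 1 - e^2 / s^2 where it is not 0; it lies between 0 and 1,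
    so that the soft cut-offs of a function and of its gradient are dominated by
    the function and the gradient themselves. *)
Definition soft_cut e s : R := if `|s| <= e then 0 else (`|s| - e) ^+ 2 / s.

(** The derivative of [soft_cut e]; with a maximum instead of a case distinction
    its continuity is immediate. *)
Definition dsoft_cut e s : R := 1 - e ^+ 2 / Num.max (e ^+ 2) (s ^+ 2).

Lemma soft_cut_le e s : 0 < e -> `|soft_cut e s| <= `|s|.
Proof.
move=> e0; rewrite /soft_cut; case: ifPn => [_|]; first by rewrite normr0.
rewrite -ltNge => es; have s0 := lt_trans e0 es.
rewrite normrM normfV normrX ler_pdivrMr// -expr2.
by rewrite lerXn2r ?nnegrE// ger0_norm ?gerBl 1?ltW// subr_gt0.
Qed.

Lemma dsoft_cut_itv e s : 0 < e -> 0 <= dsoft_cut e s <= 1.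
Proof.
move=> e0; have e2 : 0 < e ^+ 2 by rewrite exprn_gt0.
have m0 : 0 < Num.max (e ^+ 2) (s ^+ 2) by rewrite lt_max e2.
rewrite /dsoft_cut subr_ge0 ler_pdivrMr// mul1r le_max lexx/= gerBl.
by rewrite divr_ge0// ltW.
Qed.

Lemma soft_cut0 e s : `|s| <= e -> soft_cut e s = 0.
Proof. by rewrite /soft_cut => ->. Qed.

Lemma dsoft_cut_far e s : 0 < e -> e <= `|s| -> dsoft_cut e s = 1 - e ^+ 2 / s ^+ 2.
Proof.
move=> e0 es; rewrite /dsoft_cut max_r// -[s ^+ 2]real_normK ?num_real//.
by rewrite lerXn2r// nnegrE// ltW.
Qed.

Lemma dsoft_cut0 e s : 0 < e -> `|s| <= e -> dsoft_cut e s = 0.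
Proof.
move=> e0 es; rewrite /dsoft_cut max_l ?divff ?subrr ?expf_neq0 ?gt_eqF//.
by rewrite -[s ^+ 2]real_normK ?num_real// lerXn2r// nnegrE// ltW.
Qed.

Lemma dsoft_cut_continuous e : 0 < e -> continuous (dsoft_cut e).
Proof.
move=> e0 s; apply: cvgB; first exact: cvg_cst.
apply: cvgM; first exact: cvg_cst.
apply: cvgV; first by rewrite gt_eqF// lt_max exprn_gt0.
apply: (@continuous_max R R (fun=> e ^+ 2) (fun s => s ^+ 2) s).
  exact: cst_continuous.
exact: exprn_continuous.
Qed.

Lemma is_derive_soft_cut e s : 0 < e -> is_derive s 1 (soft_cut e) (dsoft_cut e s).
Proof.
move=> e0; have [se|es] := leP `|s| e.
  rewrite dsoft_cut0//; apply: (is_derive_slope0 (k := fun x => e^-1 * `|x - s|)).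
    have : e^-1 * `|x - s| @[x --> s] --> e^-1 * `|s - s|.
      apply: cvgM; first exact: cvg_cst.
      by apply: cvg_norm; apply: cvgB; [exact: cvg_id|exact: cvg_cst].
    by rewrite subrr normr0 mulr0.
  move=> x; rewrite (soft_cut0 se) subr0 /soft_cut; case: ifPn => [_|].
    by rewrite normr0 !mulr_ge0// invr_ge0 ltW.
  rewrite -ltNge => ex; have x0 := lt_trans e0 ex.
  rewrite normrM normfV normrX [leRHS](_ : _ = `|x - s| ^+ 2 * e^-1); last by ring.
  apply: ler_pM => //; rewrite ?invr_ge0 ?exprn_ge0//.
    rewrite lerXn2r ?nnegrE ?normr_ge0//.
    rewrite [leLHS]ger0_norm; last by rewrite subr_ge0 ltW.
    by apply: le_trans (lerB_dist _ _); rewrite lerD2l lerN2.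
  by rewrite lef_pV2 ?posrE// ltW.
rewrite dsoft_cut_far 1?ltW//.
have s0 : s != 0 by rewrite -normr_gt0 (lt_trans e0).
pose c : R := - (2 * e * Num.sg s).
apply: (near_eq_is_derive (f := fun x => x + c + e ^+ 2 * x^-1)).
  have : nbhs s (ball s (`|s| - e)) by apply: nbhsx_ballx; rewrite subr_gt0.
  apply: filterS => x; rewrite /ball/= => sx.
  have ex : e < `|x|.
    have : `|s| - `|x| <= `|s - x| by exact: lerB_dist.
    by move=> /le_lt_trans /(_ sx); rewrite ltrD2l ltrN2.
  have x0 : x != 0 by rewrite -normr_gt0 (lt_trans e0).
  rewrite /soft_cut leNgt ex/= /c.
  have -> : Num.sg s = Num.sg x.
    move: sx ex es; have [s1|s1|s1] := ltgtP s 0; last by rewrite s1 eqxx in s0.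
    + have [x1|x1|x1] := ltgtP x 0; last by rewrite x1 eqxx in x0.
        by rewrite !ltr0_sg.
      by rewrite (ltr0_norm s1) (gtr0_norm x1) ltr_norml; lra.
    + have [x1|x1|x1] := ltgtP x 0; last by rewrite x1 eqxx in x0.
        by rewrite (gtr0_norm s1) (ltr0_norm x1) ltr_norml; lra.
      by rewrite !gtr0_sg.
  rewrite [`|x|]normrEsg sqrrB exprMn sqr_sg x0 mul1r; field.
  by [].
apply: DeriveDef.
  apply: derivableD; first exact: derivableD.
  by apply: derivableZ; exact: derivableV.
rewrite deriveD; [|exact: derivableD|by apply: derivableZ; exact: derivableV].
rewrite deriveD// derive_id derive_cst deriveZ; last exact: derivableV.
by rewrite deriveV//= derive_id /GRing.scale/=; field.
Qed.

Lemma soft_cut_dist e s : 0 < e -> `|s - soft_cut e s| <= 2 * e.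
Proof.
move=> e0; rewrite /soft_cut; case: ifPn => [se|]; first by rewrite subr0; lra.
rewrite -ltNge => es; have s0 : s != 0 by rewrite -normr_gt0 (lt_trans e0).
have -> : s - (`|s| - e) ^+ 2 / s = e * (2 * `|s| - e) / s.
  by rewrite sqrrB -[`|s| ^+ 2]/(`|s| ^+ 2) real_normK ?num_real//; field.
rewrite normrM normfV ler_pdivrMr ?normr_gt0// normrM gtr0_norm//.
rewrite mulrC -mulrA [leRHS]mulrCA [2 * _]mulrC mulrC ler_pM2l//.
by rewrite ger0_norm; lra.
Qed.

Lemma soft_cut_cvg s : soft_cut k.+1%:R^-1 s @[k --> \oo] --> s.
Proof.
have h : (2 : R) * k.+1%:R^-1 @[k --> \oo] --> (0 : R).
  rewrite -[X in _ --> X](@mulr0 R 2).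
  by apply: cvgM; [exact: cvg_cst|exact: cvg_harmonic].
have d : (s - soft_cut k.+1%:R^-1 s) @[k --> \oo] --> (0 : R).
  apply: norm_cvg0; apply: (squeeze_cvgr _ (cvg_cst 0) h).
  by near=> k; rewrite normr_ge0/= soft_cut_dist// invr_gt0.
have -> : (fun k => soft_cut k.+1%:R^-1 s) = (fun k => s - (s - soft_cut k.+1%:R^-1 s)).
  by apply/funext => k; rewrite subKr.
rewrite -[X in _ --> X](subr0 s); apply: cvgB => //; exact: cvg_cst.
Unshelve. all: by end_near. Qed.

Lemma dsoft_cut_cvg s : s != 0 -> dsoft_cut k.+1%:R^-1 s @[k --> \oo] --> (1 : R).
Proof.
move=> s0; rewrite -[X in _ --> X]subr0; apply: cvgB; first exact: cvg_cst.
have h : s ^- 2 * (k.+1%:R^-1 * k.+1%:R^-1) @[k --> \oo] --> (0 : R).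
  rewrite -[X in _ --> X](mulr0 (s ^- 2)); apply: cvgM; first exact: cvg_cst.
  by rewrite -[X in _ --> X](mulr0 (0 : R)); apply: cvgM; exact: cvg_harmonic.
apply: (squeeze_cvgr _ (cvg_cst 0) h).
near=> k; have k0 : 0 < k.+1%:R^-1 :> R by rewrite invr_gt0.
have m0 : 0 < Num.max (k.+1%:R^-1 ^+ 2) (s ^+ 2) by rewrite lt_max exprn_gt0.
have e2 : 0 < k.+1%:R^-1 ^+ 2 :> R by rewrite exprn_gt0.
rewrite divr_ge0 ?(ltW e2) ?(ltW m0)//= -expr2 [leRHS]mulrC ler_pM2l//.
by rewrite lef_pV2 ?posrE ?exprn_even_gt0// le_max lexx orbT.
Unshelve. all: by end_near. Qed.

Lemma abs_powR_continuous r : 0 < r -> continuous (fun s => `|s| `^ r).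
Proof.
move=> r0 s; have [->|s0] := eqVneq s 0.
  rewrite /continuous_at normr0 powR0 ?gt_eqF//; apply/cvgr0Pnorm_lt => e e0.
  have d0 : 0 < e `^ r^-1 by rewrite powR_gt0.
  apply/nbhs_ballP; exists (e `^ r^-1) => //= x; rewrite /ball/= sub0r normrN => xd.
  rewrite ger0_norm ?powR_ge0//.
  have -> : e = (e `^ r^-1) `^ r by rewrite -powRrM mulVf ?gt_eqF// powRr1// ltW.
  by apply: gt0_ltr_powR => //; rewrite nnegrE ?normr_ge0// ltW.
apply: (@continuous_comp _ _ _ (fun s => `|s|) (fun x => x `^ r)).
  exact: norm_continuous.
apply: differentiable_continuous; apply/derivable1_diffP.
by apply: derivable_powR; rewrite in_itv/= andbT normr_gt0.
Qed.

Lemma is_derive_signed_powR r s : 0 < r ->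
  is_derive s 1 (fun s => s * `|s| `^ r) ((r + 1) * `|s| `^ r).
Proof.
move=> r0; have [->|s0] := eqVneq s 0.
  rewrite normr0 powR0 ?gt_eqF// mulr0.
  apply: (is_derive_slope0 (k := fun x => `|x| `^ r)).
    have := @abs_powR_continuous r r0 0.
    by rewrite /continuous_at normr0 powR0 ?gt_eqF.
  by move=> x; rewrite mul0r !subr0 normrM (ger0_norm (powR_ge0 _ _)) mulrC.
have ss0 : 0 < Num.sg s * s by rewrite -normrEsg normr_gt0.
apply: (@near_eq_is_derive R R R (fun x => x * (Num.sg s * x) `^ r)).
  have : \forall x \near s, 0 < Num.sg s * x.
    have : Num.sg s * x @[x --> s] --> Num.sg s * s.
      by apply: cvgM; [exact: cvg_cst|exact: cvg_id].
    by move/cvgr_gt; exact.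
  apply: filterS => x x0; congr (_ * _ `^ r).
  have sg2 : Num.sg s * Num.sg s = 1 by rewrite -expr2 sqr_sg s0.
  have -> : x = Num.sg s * (Num.sg s * x) by rewrite mulrA sg2 mul1r.
  by rewrite normrM normr_sg s0 mul1r mulrA sg2 mul1r gtr0_norm.
have dp : is_derive s 1 (fun x => (Num.sg s * x) `^ r)
    (r * (Num.sg s * s) `^ (r - 1) * Num.sg s).
  have dl : is_derive s 1 (Num.sg s *: (id : R -> R)) (Num.sg s).
    apply: DeriveDef; first exact: derivableZ.
    by rewrite deriveZ// derive_id /GRing.scale/= mulr1.
  exact: (is_derive1_comp (is_derive1_powR r ss0) dl).
apply: DeriveDef; first by apply: derivableM; [exact: derivable_id|case: dp].
rewrite deriveM; [|exact: derivable_id|by case: dp].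
rewrite derive_id; case: dp => _ ->; rewrite normrEsg /GRing.scale/= mulr1.
rewrite -[X in _ + X = _]mul1r.
have -> : (Num.sg s * s) `^ r = (Num.sg s * s) * (Num.sg s * s) `^ (r - 1).
  by rewrite mulr_powRB1 1?ltW.
ring.
Qed.

End one_variable.

(** * Calculus of partial derivatives *)

Section pointwise_continuity.
Context {R : realType} {T : topologicalType}.
Implicit Types (f g : T -> R) (x : T).

Lemma for_continuousM f g x : {for x, continuous f} -> {for x, continuous g} ->
  {for x, continuous (fun x => f x * g x)}.
Proof. by move=> cf cg; exact: (continuousM cf cg). Qed.

Lemma for_continuous_lin f g (a b : R) x :
  {for x, continuous f} -> {for x, continuous g} ->
  {for x, continuous (a *: f + b *: g)}.
Proof.
move=> cf cg; apply: continuousD.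
  exact: (@for_continuousM (cst a) f x (@cst_continuous _ _ a x) cf).
exact: (@for_continuousM (cst b) g x (@cst_continuous _ _ b x) cg).
Qed.

End pointwise_continuity.

Section C1_calculus.
Context {R : realType} (n : nat) (Om : set 'rV[R]_n).
Hypothesis oOm : open Om.
Implicit Types (f g : 'rV[R]_n -> R) (x v : 'rV[R]_n) (i : 'I_n).

Let e_ i : 'rV[R]_n := delta_mx ord0 i.

Lemma class_C_continuous k f x : class_C k Om f -> Om x -> {for x, continuous f}.
Proof. by case: k => [|k] [cf _]; exact: cf. Qed.

Lemma class_C_is_derive k f i x : class_C k.+1 Om f -> Om x ->
  is_derive x (e_ i) f (partial i f x).
Proof. by move=> [_ df] Ox; apply/derivableP; have [+ _] := df i; exact. Qed.

Lemma class_C_partial k f i : class_C k.+1 Om f -> class_C k Om (partial i f).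
Proof. by move=> [_ df]; case: (df i). Qed.

Lemma partialE f i x d : is_derive x (e_ i) f d -> partial i f x = d.
Proof. by case. Qed.

Lemma class_C1 f (f' : 'I_n -> 'rV[R]_n -> R) : (forall x, Om x -> {for x, continuous f}) ->
  (forall i x, Om x -> is_derive x (e_ i) f (f' i x)) ->
  (forall i x, Om x -> {for x, continuous (f' i)}) -> class_C 1 Om f.
Proof.
move=> cf df cf'; split=> // i; split; first by move=> x Ox; case: (df i x Ox).
split=> // x Ox; suff: partial i f y @[y --> x] --> partial i f x by [].
rewrite [X in _ --> X](partialE (df i x Ox)).
have cfx : f' i y @[y --> x] --> f' i x by exact: cf'.
have e : \forall y \near x, f' i y = partial i f y.
  have : nbhs x Om by exact: open_nbhs_nbhs.
  by apply: filterS => y Oy; rewrite (partialE (df i y Oy)).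
exact: (cvg_trans (near_eq_cvg e) cfx).
Qed.

(** Only derivatives along one direction are available, so the chain rule is read
    off the restriction of f to a line. *)
Lemma is_derive_along f h x v (d d' : R) :
  is_derive x v f d -> is_derive (f x) 1 h d' -> is_derive x v (h \o f) (d' * d).
Proof.
move=> df dh; pose F g (s : R) : R := g (s *: v + x).
have F0 g : F g 0 = g x by rewrite /F scale0r add0r.
have dF : is_derive (0 : R) (1 : R) (F f : R -> R) d.
  by apply: is_derive_line; rewrite scale0r add0r.
have dhF : is_derive (0 : R) (1 : R) (F (h \o f) : R -> R) (d' * d).
  by apply: (is_derive1_comp (f := h) (g := F f)); rewrite F0.
have E : (fun t : R => t^-1 *: (F (h \o f) (t *: (1 : R) + 0) - F (h \o f) 0))
    = (fun t : R => t^-1 *: ((h \o f) (t *: v + x) - (h \o f) x)).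
  by apply/funext => t; rewrite F0 /F [t *: 1]mulr1 addr0.
case: dhF => h1 h2; apply: DeriveDef.
  by move: h1; rewrite /derivable /= E.
by move: h2; rewrite /derive /= E.
Qed.

Lemma is_derive_mul f g x v (d d' : R) : is_derive x v f d -> is_derive x v g d' ->
  is_derive x v (fun x => f x * g x) (d * g x + f x * d').
Proof.
move=> [h1 h2] [h3 h4]; apply: DeriveDef; first exact: (derivableM h1 h3).
rewrite -[LHS]/('D_v (f * g) x) (deriveM h1 h3) h2 h4 addrC.
by rewrite /GRing.scale/= [g x * d]mulrC.
Qed.

Lemma is_derive_lin f g (a b : R) x v (d d' : R) :
  is_derive x v f d -> is_derive x v g d' ->
  is_derive x v (a *: f + b *: g) (a * d + b * d').
Proof.
move=> df dg; exact: (is_deriveD (is_deriveZ a df) (is_deriveZ b dg)).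
Qed.

Lemma is_derive_coord x i j :
  is_derive x (e_ i) (fun x => x ord0 j) (i == j)%:R.
Proof.
have E : (fun h : R => h^-1 *: ((h *: e_ i + x) ord0 j - x ord0 j)) @ 0^' -->
    ((i == j)%:R : R).
  have c : (cst (i == j)%:R : R -> R) h @[h --> 0^'] --> ((i == j)%:R : R).
    exact: cvg_cst.
  apply: cvg_trans c; apply: near_eq_cvg; near=> h.
  have h0 : h != 0 by near: h; exact: nbhs_dnbhs_neq.
  by rewrite !mxE eqxx/= addrK /GRing.scale/= mulrA mulVf// mul1r eq_sym.
apply: DeriveDef; first by apply/cvg_ex; exists (i == j)%:R.
exact/cvg_lim.
Unshelve. all: by end_near. Qed.

Lemma class_C1_mul f g : class_C 1 Om f -> class_C 1 Om g ->
  class_C 1 Om (fun x => f x * g x).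
Proof.
move=> Cf Cg.
have cf i x (Ox : Om x) := class_C_continuous (class_C_partial i Cf) Ox.
have cg i x (Ox : Om x) := class_C_continuous (class_C_partial i Cg) Ox.
apply: (@class_C1 _ (fun i x => partial i f x * g x + f x * partial i g x)).
- by move=> x Ox; apply: for_continuousM;
    [exact: (class_C_continuous Cf Ox)|exact: (class_C_continuous Cg Ox)].
- by move=> i x Ox; exact: (is_derive_mul (class_C_is_derive i Cf Ox)
    (class_C_is_derive i Cg Ox)).
- move=> i x Ox; apply: continuousD; apply: for_continuousM.
  + exact: cf.
  + exact: (class_C_continuous Cg Ox).
  + exact: (class_C_continuous Cf Ox).
  + exact: cg.
Qed.

Lemma class_C1_comp f (h h' : R -> R) :
  (forall s : R, is_derive s (1 : R) h (h' s)) -> continuous h' ->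
  class_C 1 Om f -> class_C 1 Om (h \o f).
Proof.
move=> dh ch' Cf.
have ch : continuous h.
  by move=> s; apply/differentiable_continuous/derivable1_diffP; case: (dh s).
apply: (@class_C1 _ (fun i x => h' (f x) * partial i f x)).
- move=> x Ox; apply: continuous_comp; last exact: ch.
  exact: (class_C_continuous Cf Ox).
- by move=> i x Ox; exact: (is_derive_along (class_C_is_derive i Cf Ox) (dh _)).
- move=> i x Ox; apply: for_continuousM.
    apply: continuous_comp; last exact: ch'.
    exact: (class_C_continuous Cf Ox).
  exact: (class_C_continuous (class_C_partial i Cf) Ox).
Qed.

Lemma class_C1_coord (j : 'I_n) : class_C 1 Om (fun x => x ord0 j).
Proof.
apply: (@class_C1 _ (fun i _ => (i == j)%:R)).
- by move=> x _; exact: coord_continuous.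
- by move=> i x _; exact: is_derive_coord.
- by move=> i x _; exact: cst_continuous.
Qed.

Lemma class_C1_lin f g (a b : R) : class_C 1 Om f -> class_C 1 Om g ->
  class_C 1 Om (a *: f + b *: g).
Proof.
move=> Cf Cg; pose F i x := a * partial i f x + b * partial i g x.
have cF i x : Om x -> {for x, continuous (F i)}.
  move=> Ox; apply: for_continuous_lin.
    exact: (class_C_continuous (class_C_partial i Cf) Ox).
  exact: (class_C_continuous (class_C_partial i Cg) Ox).
have cfg x : Om x -> {for x, continuous (a *: f + b *: g)}.
  move=> Ox; apply: for_continuous_lin; first exact: (class_C_continuous Cf Ox).
  exact: (class_C_continuous Cg Ox).
have dfg i x (Ox : Om x) :=
  is_derive_lin a b (class_C_is_derive i Cf Ox) (class_C_is_derive i Cg Ox).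
exact: (class_C1 cfg dfg cF).
Qed.

Lemma partial_lin f g (a b : R) i x : class_C 1 Om f -> class_C 1 Om g -> Om x ->
  partial i (a *: f + b *: g) x = a * partial i f x + b * partial i g x.
Proof.
move=> Cf Cg Ox; exact: (partialE (is_derive_lin a b (class_C_is_derive i Cf Ox)
  (class_C_is_derive i Cg Ox))).
Qed.

Lemma partial_mul f g i x : class_C 1 Om f -> class_C 1 Om g -> Om x ->
  partial i (fun x => f x * g x) x = partial i f x * g x + f x * partial i g x.
Proof.
move=> Cf Cg Ox; exact: (partialE (is_derive_mul (class_C_is_derive i Cf Ox)
  (class_C_is_derive i Cg Ox))).
Qed.

Lemma partial_coord i j x : partial i (fun x : 'rV[R]_n => x ord0 j) x = (i == j)%:R.
Proof. exact/partialE/is_derive_coord. Qed.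

Lemma partial_comp f (h h' : R -> R) i x :
  (forall s : R, is_derive s (1 : R) h (h' s)) -> class_C 1 Om f -> Om x ->
  partial i (h \o f) x = h' (f x) * partial i f x.
Proof.
move=> dh Cf Ox; exact: (partialE (is_derive_along (class_C_is_derive i Cf Ox) (dh _))).
Qed.

Lemma vanishing_lin f g (a b : R) : vanishing Om f -> vanishing Om g ->
  vanishing Om (a *: f + b *: g).
Proof.
move=> [cf f0] [cg g0]; split.
  by move=> x; exact: (@for_continuous_lin R (subspace (closure Om)) f g a b x (cf x) (cg x)).
move=> x bx; rewrite -[LHS]/(a * f x + b * g x) f0// g0//.
by rewrite !mulr0 addr0.
Qed.

Lemma vanishing_mul f g : {within closure Om, continuous f} ->
  vanishing Om g -> vanishing Om (fun x => f x * g x).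
Proof.
move=> cf [cg g0]; split; last by move=> x bx; rewrite g0// mulr0.
by move=> x; exact: (@for_continuousM R (subspace (closure Om)) f g x (cf x) (cg x)).
Qed.

Lemma vanishing_comp f (h : R -> R) : continuous h -> h 0 = 0 ->
  vanishing Om f -> vanishing Om (h \o f).
Proof.
move=> ch h0 [cf f0]; split; last by move=> x bx /=; rewrite f0.
by move=> x; exact: (@continuous_comp (subspace (closure Om)) R R f h x (cf x) (ch _)).
Qed.

End C1_calculus.

(** * Square-integrable functions *)

Section integrals.
Context {R : realType} (n : nat) (Om : set 'rV[R]_n).
Hypothesis mOm : measurable Om.
Implicit Types (f g : 'rV[R]_n -> R).
Local Notation mu := (lebesgue_rV n).

Lemma integrable_real_le f g : measurable_fun Om f ->
  mu.-integrable Om (EFin \o g) -> (forall x, Om x -> `|f x| <= g x) ->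
  mu.-integrable Om (EFin \o f).
Proof.
move=> mf ig fg; apply: (le_integrable mOm _ _ ig); first exact/measurable_EFinP.
by move=> x Ox; rewrite /= lee_fin (le_trans (fg x Ox))// ler_norm.
Qed.

Lemma square_integrable_mul f g : square_integrable Om f -> square_integrable Om g ->
  mu.-integrable Om (EFin \o (fun x => f x * g x)).
Proof.
move=> [mf f2] [mg g2].
apply: (@integrable_real_le _ (fun x => f x ^+ 2 + g x ^+ 2)).
- exact: measurable_funM.
- exact: (integrableD mOm f2 g2).
- move=> x _; rewrite normrM -[f x ^+ 2]real_normK ?num_real//.
  rewrite -[g x ^+ 2]real_normK ?num_real//.
  have := sqr_ge0 (`|f x| - `|g x|); rewrite sqrrB.
  have := mulr_ge0 (normr_ge0 (f x)) (normr_ge0 (g x)); lra.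
Qed.

Lemma square_integrable_lin f g (a b : R) : square_integrable Om f ->
  square_integrable Om g -> square_integrable Om (a *: f + b *: g).
Proof.
move=> sf sg; have [[mf f2] [mg g2]] := (sf, sg); split.
  by apply: measurable_funD; apply: measurable_funM.
have e : (fun x => ((a *: f + b *: g) x ^+ 2)%:E) =
   (fun x => (a ^+ 2)%:E * (f x ^+ 2)%:E + ((2 * a * b)%:E * (f x * g x)%:E +
             (b ^+ 2)%:E * (g x ^+ 2)%:E))%E.
  apply/funext => x; rewrite -!EFinM -!EFinD; congr EFin.
  by rewrite -[(a *: f + b *: g) x]/(a * f x + b * g x); ring.
rewrite e; apply: integrableD => //; first exact: integrableZl.
apply: integrableD => //; apply: integrableZl => //.
exact: square_integrable_mul.
Qed.

Lemma square_integrable_bounded_mul f g (C : R) : measurable_fun Om f ->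
  (forall x, Om x -> `|f x| <= C) -> square_integrable Om g ->
  square_integrable Om (fun x => f x * g x).
Proof.
move=> mf fC [mg g2]; split; first exact: measurable_funM.
apply: (@integrable_real_le (fun x => (f x * g x) ^+ 2) (fun x => C ^+ 2 * g x ^+ 2)).
- by apply: measurable_funX; exact: measurable_funM.
- exact: (integrableZl mOm (C ^+ 2) g2).
- move=> x Ox; rewrite normrX normrM exprMn (real_normK (num_real (g x))).
  have C0 : 0 <= C := le_trans (normr_ge0 _) (fC x Ox).
  by rewrite ler_wpM2r ?sqr_ge0// lerXn2r// fC.
Qed.

Lemma square_integrable_bounded f (C : R) : (mu Om < +oo)%E -> measurable_fun Om f ->
  (forall x, Om x -> `|f x| <= C) -> square_integrable Om f.
Proof.
move=> fin mf fC; split => //.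
apply: (measurable_bounded_integrable mOm fin (f := fun x => f x ^+ 2)).
  exact: measurable_funX.
exists (C ^+ 2); split; first exact: num_real.
move=> M CM x Ox /=; apply: le_trans (ltW CM).
by rewrite normrX lerXn2r ?nnegrE ?fC// (le_trans _ (fC x Ox)).
Qed.

Lemma dominated_Rintegral (f_ : nat -> 'rV[R]_n -> R) f g (N : set 'rV[R]_n) :
  measurable N -> mu N = 0%E ->
  (forall k, measurable_fun Om (f_ k)) -> measurable_fun Om f ->
  mu.-integrable Om (EFin \o g) ->
  (forall k x, Om x -> `|f_ k x| <= g x) ->
  (forall x, Om x -> ~ N x -> f_ k x @[k --> \oo] --> f x) ->
  \int[mu]_(x in Om) f_ k x @[k --> \oo] --> \int[mu]_(x in Om) f x.
Proof.
move=> mN N0 mf_ mf ig fg cf.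
have [|||||i _ c] := @dominated_convergence _ _ _ mu _ mOm
  (fun k => EFin \o f_ k) (EFin \o f) (EFin \o g).
- by move=> k; exact/measurable_EFinP.
- exact/measurable_EFinP.
- exists N; split => // x /= /not_implyP[Ox nc]; apply: contrapT => nN; apply: nc.
  by apply: cvg_EFin; [exact: nearW|exact: cf].
- exact: ig.
- by apply: aeW => x k Ox; rewrite /= lee_fin; exact: fg.
apply: fine_cvg; rewrite fineK; last exact: integrable_fin_num.
exact: c.
Qed.

End integrals.

(** * Integration by parts *)

Lemma Rintegral_sum d (T : measurableType d) (R : realType)
    (mu : {measure set T -> \bar R}) (D : set T) (I : Type) (s : seq I)
    (f : I -> T -> R) : measurable D ->
  (forall i, mu.-integrable D (EFin \o f i)) ->
  mu.-integrable D (EFin \o (fun x => \sum_(i <- s) f i x)) /\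
  \int[mu]_(x in D) (\sum_(i <- s) f i x) = \sum_(i <- s) \int[mu]_(x in D) f i x.
Proof.
move=> mD fi; elim: s => [|i s [IHi IH]].
  have e : (fun x => \sum_(i <- [::]) f i x) = cst 0.
    by apply/funext => x; rewrite big_nil.
  rewrite e big_nil; split; first exact: integrable0.
  by rewrite /Rintegral integral0.
have e : (fun x => \sum_(j <- i :: s) f j x) = (fun x => f i x + \sum_(j <- s) f j x).
  by apply/funext => x; rewrite big_cons.
rewrite e big_cons RintegralD// IH; split => //.
exact: (integrableD mD (fi i) IHi).
Qed.

Lemma cvgn_sum (R : realType) (I : Type) (s : seq I) (a : I -> nat -> R) (l : I -> R) :
  (forall i, a i k @[k --> \oo] --> l i) ->
  \sum_(i <- s) a i k @[k --> \oo] --> \sum_(i <- s) l i.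
Proof.
move=> al; elim: s => [|i s IH].
  rewrite big_nil (_ : (fun k => _) = cst 0); first exact: cvg_cst.
  by apply/funext => k; rewrite big_nil.
rewrite big_cons (_ : (fun k => _) = (fun k => a i k + \sum_(j <- s) a j k)).
  exact: cvgD.
by apply/funext => k; rewrite big_cons.
Qed.

Section weak_gradient.
Context {R : realType} (n : nat) (Om : set 'rV[R]_n) (B : R).
Hypotheses (oOm : open Om) (B0 : 0 <= B) (OmB : Om `<=` box n B).
Implicit Types (f g G H : 'rV[R]_n -> R) (i : 'I_n).
Local Notation mu := (lebesgue_rV n).

Let mOm : measurable Om := measurable_dom oOm.
Let fOm : (mu Om < +oo)%E := lebesgue_dom oOm B0 OmB.

Let e_gt0 k : 0 < k.+1%:R^-1 :> R. Proof. by rewrite invr_gt0. Qed.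

Lemma class_C_measurable k f : class_C k Om f -> measurable_fun Om f.
Proof.
move=> Cf; apply: open_continuous_measurable_rV => // x Ox.
exact: (class_C_continuous Cf Ox).
Qed.

Lemma for_continuous_comp f (h : R -> R) x : {for x, continuous f} ->
  continuous h -> {for x, continuous (h \o f)}.
Proof. by move=> cf ch; apply: continuous_comp; [exact: cf|exact: ch]. Qed.

Lemma soft_cut_continuous (e : R) : 0 < e -> continuous (soft_cut e).
Proof.
move=> e0 s; apply/differentiable_continuous/derivable1_diffP.
by case: (is_derive_soft_cut s e0).
Qed.

(** G differs by at most a constant from a soft cut-off of G, whose extension by 0
    is continuous with bounded support. *)
Lemma vanishing_bounded G : class_C 1 Om G -> vanishing Om G ->
  exists C, forall x, Om x -> `|G x| <= C.
Proof.
move=> CG vG.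
have [] := ext_bounded oOm OmB vG ltr01 (K := soft_cut 1 \o G).
- by move=> x _; exact: soft_cut0.
- move=> x Ox; apply: for_continuous_comp; last exact: soft_cut_continuous.
  exact: (class_C_continuous CG Ox).
move=> C CP; exists (C + 2 * 1) => x Ox; rewrite -(subrK (soft_cut 1 (G x)) (G x)) addrC.
rewrite (le_trans (ler_normD _ _))// lerD//; first exact: CP.
exact: soft_cut_dist.
Qed.

Lemma soft_cut_cut_off G (e : R) f : cut_off Om G e (fun x => soft_cut e (G x) * f x).
Proof. by move=> x _ Ge; rewrite soft_cut0// mul0r. Qed.

Lemma dsoft_cut_cut_off G (e : R) f : 0 < e ->
  cut_off Om G e (fun x => dsoft_cut e (G x) * f x).
Proof. by move=> e0 x _ Ge; rewrite dsoft_cut0// mul0r. Qed.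

(** The derivative of a soft cut-off of G has integral 0. These derivatives can
    fail to converge to the derivative of G only where G = 0 and the derivative
    of G is not 0, which is a null set. *)
Lemma integral_partial0 G i : class_C 1 Om G -> vanishing Om G ->
  mu.-integrable Om (EFin \o partial i G) ->
  integral_on Om (partial i G) = 0.
Proof.
move=> CG vG iG.
have cG x (Ox : Om x) := class_C_continuous CG Ox.
have cdG x (Ox : Om x) := class_C_continuous (class_C_partial i CG) Ox.
have dG x (Ox : Om x) := class_C_is_derive i CG Ox.
have [mZ Z0] := @simple_zeros_null _ _ i _ _ _ oOm B0 OmB cG
  (fun x Ox => let: DeriveDef d _ := dG x Ox in d) cdG.
pose f k x := dsoft_cut k.+1%:R^-1 (G x) * partial i G x.
have cf k x : Om x -> {for x, continuous (f k)}.
  move=> Ox; apply: for_continuousM; last exact: cdG.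
  by apply: for_continuous_comp; [exact: cG|exact: dsoft_cut_continuous].
have f0 k : \int[mu]_(x in Om) f k x = 0.
  apply: (integral_cut_off_partial oOm B0 OmB vG (e_gt0 k) (i := i)
    (K := soft_cut k.+1%:R^-1 \o G)).
  - by move=> x _; exact: soft_cut0.
  - exact: dsoft_cut_cut_off.
  - by move=> x Ox; exact: (is_derive_along (dG x Ox) (is_derive_soft_cut _ (e_gt0 k))).
  - exact: cf.
suff c : \int[mu]_(x in Om) f k x @[k --> \oo] --> \int[mu]_(x in Om) partial i G x.
  rewrite /integral_on -(cvg_lim (@Rhausdorff R) c).
  rewrite (_ : (fun k => \int[mu]_(x in Om) f k x) = cst 0); last exact/funext.
  exact: lim_cst.
apply: (dominated_Rintegral (g := fun x => `|partial i G x|) mOm mZ Z0).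
- by move=> k; apply: open_continuous_measurable_rV => //; exact: cf.
- exact: (class_C_measurable (class_C_partial i CG)).
- exact: integrable_norm.
- move=> k x Ox; have /andP[d0 d1] := dsoft_cut_itv (G x) (e_gt0 k).
  by rewrite normrM (ger0_norm d0) ler_piMl.
- move=> x Ox nZ; have [Gx|Gx] := eqVneq (G x) 0.
    have -> : partial i G x = 0 by apply: contrapT => pG; exact: nZ.
    rewrite (_ : (fun k => _) = cst 0); first exact: cvg_cst.
    by apply/funext => k; rewrite /f Gx dsoft_cut0 ?normr0 ?mul0r// ltW.
  rewrite -[X in _ --> X]mul1r; apply: cvgM; last exact: cvg_cst.
  exact: dsoft_cut_cvg.
Qed.

(** The C^1 functions of the Sobolev space H^1_0 that are continuous up to the
    boundary. *)
Definition H10 G := [/\ class_C 1 Om G, vanishing Om G &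
  forall i, square_integrable Om (partial i G)].

Section eigenfunction.
Context (H : 'rV[R]_n -> R) (la : R).
Hypotheses (CH : class_C 2 Om H)
  (lapH : forall x, Om x -> laplacian H x = - la * H x).

(** The field soft_cut e (G) grad H vanishes near the boundary, so its divergence
    has integral 0 even when grad H is unbounded. *)
Lemma cut_green G (e : R) : 0 < e -> class_C 1 Om G -> vanishing Om G ->
  \sum_i integral_on Om (fun x => dsoft_cut e (G x) * (partial i G x * partial i H x)) =
  la * integral_on Om (fun x => soft_cut e (G x) * H x).
Proof.
move=> e0 CG vG.
have cG x (Ox : Om x) := class_C_continuous CG Ox.
have cdG i x (Ox : Om x) := class_C_continuous (class_C_partial i CG) Ox.
have cdH i x (Ox : Om x) := class_C_continuous (class_C_partial i CH) Ox.
have cddH i x (Ox : Om x) :=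
  class_C_continuous (class_C_partial i (class_C_partial i CH)) Ox.
have cH x (Ox : Om x) := class_C_continuous CH Ox.
have c1 x (Ox : Om x) : {for x, continuous (soft_cut e \o G)}.
  by apply: for_continuous_comp; [exact: cG|exact: soft_cut_continuous].
have c2 x (Ox : Om x) : {for x, continuous (dsoft_cut e \o G)}.
  by apply: for_continuous_comp; [exact: cG|exact: dsoft_cut_continuous].
have i1 i : mu.-integrable Om (EFin \o
    (fun x => dsoft_cut e (G x) * (partial i G x * partial i H x))).
  apply: (cut_off_integrable oOm B0 OmB vG e0); first exact: dsoft_cut_cut_off.
  move=> x Ox; apply: for_continuousM; first exact: c2.
  by apply: for_continuousM; [exact: cdG|exact: cdH].
have i2 i : mu.-integrable Om (EFin \o
    (fun x => soft_cut e (G x) * partial i (partial i H) x)).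
  apply: (cut_off_integrable oOm B0 OmB vG e0); first exact: soft_cut_cut_off.
  by move=> x Ox; apply: for_continuousM; [exact: c1|exact: cddH].
have i3 : mu.-integrable Om (EFin \o (fun x => soft_cut e (G x) * H x)).
  apply: (cut_off_integrable oOm B0 OmB vG e0); first exact: soft_cut_cut_off.
  by move=> x Ox; apply: for_continuousM; [exact: c1|exact: cH].
have E i : integral_on Om (fun x => dsoft_cut e (G x) * (partial i G x * partial i H x)) =
    - integral_on Om (fun x => soft_cut e (G x) * partial i (partial i H) x).
  apply/eqP; rewrite -addr_eq0 -RintegralD//; apply/eqP.
  apply: (integral_cut_off_partial oOm B0 OmB vG e0 (i := i)
    (K := fun x => soft_cut e (G x) * partial i H x)).
  - exact: soft_cut_cut_off.
  - by move=> x Ox Ge; rewrite soft_cut0// dsoft_cut0// !mul0r addr0.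
  - move=> x Ox.
    have d1 := is_derive_along (class_C_is_derive i CG Ox) (is_derive_soft_cut (G x) e0).
    have := is_derive_mul d1 (class_C_is_derive i (class_C_partial i CH) Ox).
    by rewrite -mulrA.
  - move=> x Ox; apply: continuousD; last by apply: for_continuousM; [exact: c1|exact: cddH].
    apply: for_continuousM; first exact: c2.
    by apply: for_continuousM; [exact: cdG|exact: cdH].
rewrite (eq_bigr _ (fun i _ => E i)) sumrN /integral_on.
have [_ <-] := Rintegral_sum (index_enum 'I_n) mOm i2.
rewrite -RintegralZl// -mulN1r -RintegralZl//; last first.
  by have [] := Rintegral_sum (index_enum 'I_n) mOm i2.
apply: eq_Rintegral => x; rewrite inE => Ox.
rewrite -mulr_sumr -[\sum_(i <- _) _]/(laplacian H x) lapH//; ring.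
Qed.

Hypothesis vH : vanishing Om H.

(** With G = H in [cut_green], the cut-off energies of H are bounded by a multiple
    of the integral of H^2; Fatou's lemma concludes, the cut-offs converging
    almost everywhere to the full gradient. *)
Lemma eigenfunction_H10 : H10 H.
Proof.
have CH1 : class_C 1 Om H.
  apply: (class_C1 oOm (f' := fun i => partial i H)).
  - by move=> x Ox; exact: (class_C_continuous CH Ox).
  - by move=> i x Ox; exact: (class_C_is_derive i CH Ox).
  - by move=> i x Ox; exact: (class_C_continuous (class_C_partial i CH) Ox).
split => // i.
have mi j : measurable_fun Om (partial j H).
  exact: (class_C_measurable (class_C_partial j CH)).
split => //; apply/integrableP; split; first exact/measurable_EFinP/measurable_funX.
have [C CP] := vanishing_bounded CH1 vH.
have sH : square_integrable Om H.
  by apply: (square_integrable_bounded mOm fOm _ CP); exact: (class_C_measurable CH).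
pose f k x := (dsoft_cut k.+1%:R^-1 (H x) * (partial i H x * partial i H x))%:E.
have mf k : measurable_fun Om (f k).
  apply/measurable_EFinP; apply: measurable_funM; last exact: measurable_funM.
  apply: open_continuous_measurable_rV => // x Ox; apply: for_continuous_comp.
    exact: (class_C_continuous CH Ox).
  exact: dsoft_cut_continuous.
have f0 k x : Om x -> (0 <= f k x)%E.
  move=> Ox; have /andP[d0 d1] := dsoft_cut_itv (H x) (e_gt0 k).
  by rewrite lee_fin mulr_ge0// -expr2 sqr_ge0.
have if_ k j : mu.-integrable Om (EFin \o
    (fun x => dsoft_cut k.+1%:R^-1 (H x) * (partial j H x * partial j H x))).
  apply: (cut_off_integrable oOm B0 OmB vH (e_gt0 k)); first exact: dsoft_cut_cut_off.
  move=> x Ox; have cdH := class_C_continuous (class_C_partial j CH) Ox.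
  apply: for_continuousM; last exact: for_continuousM.
  apply: for_continuous_comp; last exact: dsoft_cut_continuous.
  exact: (class_C_continuous CH Ox).
have cut_sq k x : `|soft_cut k.+1%:R^-1 (H x) * H x| <= H x ^+ 2.
  rewrite normrM -[leRHS]real_normK ?num_real// expr2 ler_wpM2r//.
  exact: soft_cut_le.
have icut k : mu.-integrable Om (EFin \o (fun x => soft_cut k.+1%:R^-1 (H x) * H x)).
  apply: (integrable_real_le mOm (g := fun x => H x ^+ 2)) => //; last by case: sH.
  apply: measurable_funM; last exact: (class_C_measurable CH).
  apply: open_continuous_measurable_rV => // x Ox; apply: for_continuous_comp.
    exact: (class_C_continuous CH Ox).
  exact: soft_cut_continuous.
pose M := `|la| * integral_on Om (fun x => H x ^+ 2).
have fM k : (\int[mu]_(x in Om) f k x <= M%:E)%E.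
  rewrite -[leLHS]fineK; last exact: (integrable_fin_num _ (if_ k i)).
  rewrite lee_fin -[leLHS]/(integral_on Om (fun x =>
    dsoft_cut k.+1%:R^-1 (H x) * (partial i H x * partial i H x))).
  have := cut_green (e_gt0 k) CH1 vH; rewrite (bigD1 i)//= => E.
  apply: (@le_trans _ _ (la * integral_on Om (fun x => soft_cut k.+1%:R^-1 (H x) * H x))).
    rewrite -E lerDl sumr_ge0// => j _; apply: Rintegral_ge0 => x Ox.
    by have /andP[d0 _] := dsoft_cut_itv (H x) (e_gt0 k); rewrite mulr_ge0// -expr2 sqr_ge0.
  apply: le_trans (ler_norm _) _; rewrite normrM ler_wpM2l//.
  apply: le_trans (le_normr_Rintegral mOm (icut k)) _.
  apply: le_Rintegral => //.
  - exact: integrable_norm (icut k).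
  - by case: sH.
have [mZ Z0] := @simple_zeros_null _ _ i _ _ _ oOm B0 OmB
  (fun x Ox => class_C_continuous CH Ox)
  (fun x Ox => let: DeriveDef d _ := class_C_is_derive i CH Ox in d)
  (fun x Ox => class_C_continuous (class_C_partial i CH) Ox).
set Z := [set x | _] in mZ Z0.
rewrite (eq_integral (fun x => (partial i H x ^+ 2)%:E)); last first.
  by move=> x _; rewrite gee0_abs// lee_fin sqr_ge0.
rewrite (ge0_negligible_integral mZ mOm _ _ Z0) //; last 2 first.
- exact/measurable_EFinP/measurable_funX.
- by move=> x _; rewrite lee_fin sqr_ge0.
have mOZ : measurable (Om `\` Z) by exact: measurableD.
have mf' k : measurable_fun (Om `\` Z) (f k).
  by apply: measurable_funS (mf k) => // x [].
have f0' k x : (Om `\` Z) x -> (0 <= f k x)%E by move=> [Ox _]; exact: f0.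
rewrite (eq_integral (fun x => limn_einf (f ^~ x))); last first.
  move=> x; rewrite inE => -[Ox nZ]; apply/esym; apply: (cvg_limn_einf_sup _).1.
  suff c : dsoft_cut k.+1%:R^-1 (H x) * (partial i H x * partial i H x)
      @[k --> \oo] --> partial i H x ^+ 2.
    by apply: cvg_EFin => //; exact: nearW.
  have [Hx|Hx] := eqVneq (H x) 0.
    have -> : partial i H x = 0 by apply: contrapT => pH; exact: nZ.
    rewrite expr0n (_ : (fun k => _) = cst 0); first exact: cvg_cst.
    by apply/funext => k; rewrite !mulr0.
  rewrite -[X in _ --> X]mul1r -expr2; apply: cvgM; last exact: cvg_cst.
  exact: dsoft_cut_cvg.
apply: (le_lt_trans (fatou mu mOZ mf' f0')).
apply: (@le_lt_trans _ _ M%:E); last exact: ltry.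
rewrite limn_einf_lim; apply: lime_le; first exact: is_cvg_einfs.
apply: nearW => k; apply: le_trans (fM k).
apply: (@le_trans _ _ (\int[mu]_(x in Om `\` Z) f k x)%E).
  by apply: ereal_inf_lbound; exists k => //=.
by apply: ge0_subset_integral => //; exact: f0.
Qed.

(** Limit of [cut_green]: the gradients are square-integrable, so that convergence
    is dominated on both sides. *)
Lemma green_first_identity G : H10 G ->
  \sum_i integral_on Om (fun x => partial i G x * partial i H x) =
  la * integral_on Om (fun x => G x * H x).
Proof.
move=> [CG vG sG]; have [CH1 _ sdH] := eigenfunction_H10.
have cG x (Ox : Om x) := class_C_continuous CG Ox.
have mG := class_C_measurable CG; have mH := class_C_measurable CH.
have [C CP] := vanishing_bounded CG vG; have [C' CP'] := vanishing_bounded CH1 vH.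
have sG0 := square_integrable_bounded mOm fOm mG CP.
have sH0 := square_integrable_bounded mOm fOm mH CP'.
have cvl i : integral_on Om (fun x => dsoft_cut k.+1%:R^-1 (G x) *
      (partial i G x * partial i H x)) @[k --> \oo] -->
    integral_on Om (fun x => partial i G x * partial i H x).
  have [mZ Z0] := @simple_zeros_null _ _ i _ _ _ oOm B0 OmB cG
    (fun x Ox => let: DeriveDef d _ := class_C_is_derive i CG Ox in d)
    (fun x Ox => class_C_continuous (class_C_partial i CG) Ox).
  have mGH : measurable_fun Om (fun x => partial i G x * partial i H x).
    by apply: measurable_funM; [case: (sG i)|case: (sdH i)].
  apply: (dominated_Rintegral mOm mZ Z0
    (g := fun x => `|partial i G x * partial i H x|)) => //.
  - move=> k; apply: measurable_funM => //.
    apply: open_continuous_measurable_rV => // x Ox.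
    by apply: for_continuous_comp; [exact: cG|exact: dsoft_cut_continuous].
  - by apply: integrable_norm; exact: square_integrable_mul.
  - move=> k x Ox; have /andP[d0 d1] := dsoft_cut_itv (G x) (e_gt0 k).
    by rewrite normrM (ger0_norm d0) ler_piMl.
  - move=> x Ox nZ; have [Gx|Gx] := eqVneq (G x) 0.
      have -> : partial i G x = 0 by apply: contrapT => pG; exact: nZ.
      rewrite mul0r (_ : (fun k => _) = cst 0); first exact: cvg_cst.
      by apply/funext => k; rewrite mulr0.
    rewrite -[X in _ --> X]mul1r; apply: cvgM; last exact: cvg_cst.
    exact: dsoft_cut_cvg.
have cvr : integral_on Om (fun x => soft_cut k.+1%:R^-1 (G x) * H x) @[k --> \oo] -->
    integral_on Om (fun x => G x * H x).
  apply: (dominated_Rintegral mOm measurable0 (measure0 _)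
    (g := fun x => `|G x * H x|)) => //.
  - move=> k; apply: measurable_funM => //.
    apply: open_continuous_measurable_rV => // x Ox.
    by apply: for_continuous_comp; [exact: cG|exact: soft_cut_continuous].
  - exact: measurable_funM.
  - by apply: integrable_norm; exact: square_integrable_mul.
  - by move=> k x Ox; rewrite !normrM ler_wpM2r// soft_cut_le.
  - move=> x Ox _; apply: cvgM; last exact: cvg_cst.
    exact: soft_cut_cvg.
have cvs : (\sum_i integral_on Om (fun x => dsoft_cut k.+1%:R^-1 (G x) *
      (partial i G x * partial i H x))) @[k --> \oo] -->
    \sum_i integral_on Om (fun x => partial i G x * partial i H x).
  exact: cvgn_sum.
rewrite -(cvg_lim (@Rhausdorff R) cvs).
under eq_fun do rewrite (cut_green (e_gt0 _) CG vG).
apply: (cvg_lim (@Rhausdorff R)); apply: cvgM => //; exact: cvg_cst.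
Qed.

End eigenfunction.
End weak_gradient.

(** * Spectral inequalities for positive forms *)

Section forms.
Context {R : realType} {V : lmodType R}.
Implicit Types (S : V -> Prop) (B : V -> V -> R).

Definition lin_closed S := forall (a b : R) f g, S f -> S g -> S (a *: f + b *: g).

Record psd_form S B : Prop := PsdForm {
  form_sym : forall f g, B f g = B g f ;
  form_lin : forall (a b : R) f g h, S f -> S g -> S h ->
    B (a *: f + b *: g) h = a * B f h + b * B g h ;
  form_ge0 : forall f, S f -> 0 <= B f f }.

Lemma lin_closed0 S f : lin_closed S -> S f -> S 0.
Proof. by move=> HS Sf; have := HS 0 0 _ _ Sf Sf; rewrite !scale0r addr0. Qed.

Lemma lin_closedB S f g : lin_closed S -> S f -> S g -> S (f - g).
Proof. by move=> HS Sf Sg; have := HS 1 (-1) _ _ Sf Sg; rewrite scale1r scaleN1r. Qed.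

Lemma lin_closed_sum S (I : Type) (s : seq I) (P : pred I) (c : I -> R) (g : I -> V) f :
  lin_closed S -> S f -> (forall i, P i -> S (g i)) ->
  S (\sum_(i <- s | P i) c i *: g i).
Proof.
move=> HS Sf Sg; elim: s => [|i s IH]; first by rewrite big_nil; exact: lin_closed0 Sf.
rewrite big_cons; case: ifP => // Pi; rewrite -[X in _ + X]scale1r.
by apply: HS => //; exact: Sg.
Qed.

Section one_form.
Context (S : V -> Prop) (B : V -> V -> R).
Hypotheses (HS : lin_closed S) (HB : psd_form S B).

Lemma form_linr (a b : R) f g h : S f -> S g -> S h ->
  B h (a *: f + b *: g) = a * B h f + b * B h g.
Proof.
move=> Sf Sg Sh; rewrite (form_sym HB) (form_lin HB)//.
by rewrite (form_sym HB f) (form_sym HB g).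
Qed.

Lemma form0r h : S h -> B h 0 = 0.
Proof.
move=> Sh; have := form_linr 0 0 Sh Sh Sh.
by rewrite !scale0r addr0 !mul0r addr0.
Qed.

Lemma formBr f g h : S f -> S g -> S h -> B h (f - g) = B h f - B h g.
Proof.
move=> Sf Sg Sh; have := form_linr 1 (-1) Sf Sg Sh.
by rewrite scale1r scaleN1r mul1r mulN1r.
Qed.

Lemma formBl f g h : S f -> S g -> S h -> B (f - g) h = B f h - B g h.
Proof. by move=> *; rewrite !(form_sym HB _ h) formBr. Qed.

Lemma form_sumr (I : Type) (s : seq I) (P : pred I) (c : I -> R) (g : I -> V) h :
  S h -> (forall i, P i -> S (g i)) ->
  B h (\sum_(i <- s | P i) c i *: g i) = \sum_(i <- s | P i) c i * B h (g i).
Proof.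
move=> Sh Sg; elim: s => [|i s IH]; first by rewrite !big_nil form0r.
rewrite !big_cons; case: ifP => // Pi; rewrite -[X in _ + X]scale1r.
rewrite form_linr ?mul1r ?IH//; first exact: Sg.
exact: lin_closed_sum Sh Sg.
Qed.

Lemma form_cauchy_schwarz f g : S f -> S g -> B f g ^+ 2 <= B f f * B g g.
Proof.
move=> Sf Sg.
have q t : 0 <= B f f + 2 * t * B f g + t ^+ 2 * B g g.
  have := form_ge0 HB (HS 1 t Sf Sg).
  rewrite (form_lin HB)//; last exact: HS.
  by rewrite !form_linr// (form_sym HB g f); lra.
have [g0|g0] := eqVneq (B g g) 0.
  rewrite g0 mulr0; have [->|fg0] := eqVneq (B f g) 0; first by rewrite expr0n.
  have := q (- (B f f + 1) / (2 * B f g)); rewrite g0 mulr0 addr0.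
  have -> : 2 * (- (B f f + 1) / (2 * B f g)) * B f g = - (B f f + 1) by field.
  by lra.
have g1 : 0 < B g g by rewrite lt_def g0 (form_ge0 HB).
have := q (- B f g / B g g).
have -> : B f f + 2 * (- B f g / B g g) * B f g + (- B f g / B g g) ^+ 2 * B g g =
  (B f f * B g g - B f g ^+ 2) / B g g by field.
by rewrite pmulr_lge0 ?invr_gt0// subr_ge0.
Qed.

End one_form.

(** Energy left after projecting G on finitely many members of a family that is
    orthonormal for ip and diagonal for E. *)
Lemma form_residual (S : V -> Prop) (ip E : V -> V -> R) (u : nat -> V)
    (la : nat -> R) G N : lin_closed S -> psd_form S ip -> psd_form S E ->
  (forall j, (0 < j)%N -> S (u j)) ->
  (forall j G, (0 < j)%N -> S G -> E G (u j) = la j * ip G (u j)) ->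
  (forall j k, (0 < j)%N -> (0 < k)%N -> ip (u j) (u k) = (j == k)%:R) ->
  S G ->
  let s := \sum_(1 <= j < N.+1) ip G (u j) *: u j in
  S s /\ E (G - s) (G - s) =
    E G G - \sum_(1 <= j < N.+1) la j * ip G (u j) ^+ 2.
Proof.
move=> HS Hip HE Su uE uu SG.
pose P j := (1 <= j < N.+1)%N.
have P0 j : P j -> (0 < j)%N by case/andP.
have -> : \sum_(1 <= j < N.+1) ip G (u j) *: u j =
  \sum_(1 <= j < N.+1 | P j) ip G (u j) *: u j by rewrite big_nat.
set s := \sum_(1 <= j < N.+1 | P j) ip G (u j) *: u j.
have Su' j : P j -> S (u j) by move/P0; exact: Su.
have Ss : S s by exact: lin_closed_sum SG Su'.
have Es h : S h -> E h s = \sum_(1 <= j < N.+1 | P j) la j * ip G (u j) * ip h (u j).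
  move=> Sh; rewrite (form_sumr HS HE)//; apply: eq_bigr => j Pj.
  by rewrite uE ?P0//; ring.
have sj j : P j -> ip s (u j) = ip G (u j).
  move=> Pj; rewrite (form_sym Hip) (form_sumr HS Hip)//; last exact: Su'.
  rewrite /P -big_nat (bigD1_seq j)/=; last 2 first.
  - by rewrite mem_index_iota.
  - exact: iota_uniq.
  rewrite uu ?P0// eqxx mulr1 big1_seq ?addr0// => k /andP[kj].
  by rewrite mem_index_iota => /P0 k0; rewrite uu ?(P0 _ Pj)// eq_sym (negbTE kj) mulr0.
split => //.
rewrite (formBr HE)//; last exact: lin_closedB.
rewrite !(formBl HE)// (form_sym HE s G) !Es// [in RHS]big_nat.
rewrite (eq_bigr (fun j => la j * ip G (u j) ^+ 2)); last by move=> j _; ring.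
rewrite [X in _ - _ - (_ - X)](eq_bigr (fun j => la j * ip G (u j) ^+ 2)).
  by rewrite subrr subr0.
by move=> j Pj; rewrite sj//; ring.
Qed.

Section spectral.
Context (S : V -> Prop) (ip E : V -> V -> R) (u : nat -> V) (la : nat -> R).
Hypotheses (HS : lin_closed S) (Hip : psd_form S ip) (HE : psd_form S E).
Hypotheses (Su : forall j, (0 < j)%N -> S (u j))
  (uE : forall j G, (0 < j)%N -> S G -> E G (u j) = la j * ip G (u j))
  (uu : forall j k, (0 < j)%N -> (0 < k)%N -> ip (u j) (u k) = (j == k)%:R)
  (parseval : forall G, S G ->
     \sum_(1 <= j < N.+1) ip G (u j) ^+ 2 @[N --> \oo] --> ip G G)
  (la12 : la 1 < la 2)
  (la_nd : forall j, (2 <= j)%N -> la j <= la j.+1).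

Lemma eigenvalue_le i j : (0 < i)%N -> (i <= j)%N -> la i <= la j.
Proof.
move=> i0; elim: j => [|j IH]; first by rewrite leqNgt i0.
rewrite leq_eqVlt => /predU1P[->//|]; rewrite ltnS => ij.
apply: le_trans (IH ij) _; move: (leq_trans i0 ij) => {IH ij}.
by case: j => // -[|j] _; [exact: ltW|exact: la_nd].
Qed.

Lemma eigenvalue_gt j : (2 <= j)%N -> la 1 < la j.
Proof. by move=> j2; apply: lt_le_trans la12 _; exact: eigenvalue_le. Qed.

Lemma energy_bessel G N : S G ->
  \sum_(1 <= j < N.+1) la j * ip G (u j) ^+ 2 <= E G G.
Proof.
move=> SG; have [Ss e] := form_residual N HS Hip HE Su uE uu SG.
by rewrite -subr_ge0 -e; apply: (form_ge0 HE); exact: lin_closedB.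
Qed.

(** In the expansion of G the terms with j > l have a nonpositive factor
    la l.+1 - la j, and may be dropped. *)
Lemma spectral_gap G l : S G ->
  la l.+1 * ip G G <= E G G +
    \sum_(1 <= j < l.+1) (la l.+1 - la j) * ip G (u j) ^+ 2.
Proof.
move=> SG.
have c : la l.+1 * (\sum_(1 <= j < N.+1) ip G (u j) ^+ 2) @[N --> \oo] -->
    la l.+1 * ip G G.
  by apply: cvgM; [exact: cvg_cst|exact: parseval].
rewrite -(cvg_lim (@Rhausdorff R) c); apply: limr_le.
  by apply/cvg_ex; exists (la l.+1 * ip G G).
near=> N.
have lN : (l <= N)%N by near: N; exact: nbhs_infty_ge.
apply: le_trans (lerD (energy_bessel N SG) (lexx _)).
rewrite -lerBlDl mulr_sumr -sumrB (big_cat_nat (n := l.+1))//=.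
rewrite [X in X + _](eq_bigr (fun j => (la l.+1 - la j) * ip G (u j) ^+ 2)); last first.
  by move=> j _; ring.
rewrite gerDl big_nat sumr_le0// => j /andP[lj _].
by rewrite -mulrBl mulr_le0_ge0 ?sqr_ge0// subr_le0 eigenvalue_le.
Unshelve. all: by end_near. Qed.

Definition defect f g : R := E f g - la 1 * ip f g.

(** Positivity is the Poincare inequality, which is the case l = 0 of
    [spectral_gap]. *)
Lemma defect_psd : psd_form S defect.
Proof.
split.
- by move=> f g; rewrite /defect (form_sym HE) (form_sym Hip).
- move=> a b f g h Sf Sg Sh.
  by rewrite /defect (form_lin HE)// (form_lin Hip)//; ring.
- move=> f Sf; rewrite /defect subr_ge0.
  by have := spectral_gap 0 Sf; rewrite big_geq// addr0.
Qed.

Lemma defect_gap G l : S G -> ip G (u 1) = 0 ->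
  (la l.+1 - la 1) * ip G G <= defect G G +
    \sum_(2 <= j < l.+1) (la l.+1 - la j) * ip G (u j) ^+ 2.
Proof.
move=> SG G1; have := spectral_gap l SG; rewrite /defect.
case: l => [|l]; first by rewrite !big_geq//; lra.
by rewrite [X in _ <= _ + X -> _]big_ltn// G1 expr0n/= mulr0 add0r; lra.
Qed.

Lemma defect_eigen G j : (0 < j)%N -> S G ->
  defect G (u j) = (la j - la 1) * ip G (u j).
Proof. by move=> j0 SG; rewrite /defect uE//; ring. Qed.

Section coordinates.
Context (n : nat) (Z : 'I_n -> V).
Hypotheses (SZ : forall i, S (Z i))
  (ZZ : forall i k, defect (Z i) (Z k) = (i == k)%:R)
  (Z1 : forall i, ip (Z i) (u 1) = 0).

Let a (i : 'I_n) j := ip (Z i) (u j).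

Lemma coordinate_gap (i : 'I_n) k :
  (forall j, (2 <= j <= i.+1)%N -> a i j = 0) ->
  (la k.+1 - la 1) * ip (Z i) (Z i) <=
    1 + \sum_(i.+2 <= j < k.+1) (la k.+1 - la j) * a i j ^+ 2.
Proof.
move=> a0; apply: le_trans (defect_gap k (SZ i) (Z1 i)) _.
rewrite ZZ eqxx lerD2l.
have z m : (m <= i.+2)%N ->
    \sum_(2 <= j < m) (la k.+1 - la j) * ip (Z i) (u j) ^+ 2 = 0.
  move=> mi; rewrite big_nat big1// => j /andP[j2 jm].
  rewrite -/(a i j) a0 ?expr0n ?mulr0// j2/= -ltnS.
  exact: leq_trans mi.
have [ki|ki] := leqP k.+1 i.+2; first by rewrite z// big_geq.
by rewrite (big_cat_nat (n := i.+2)) ?(ltnW ki)//= z// add0r.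
Qed.

(** [(la j - la 1) * bracket j] is the defect energy of the residual below. *)
Let bracket j := 1 - (la j - la 1) * \sum_i a i j ^+ 2.

(** The part of the eigenvector that is orthogonal, for the defect form, to
    all the Z i. *)
Lemma coordinate_residual j : (2 <= j)%N -> exists W, [/\ S W,
  defect W W = (la j - la 1) * bracket j &
  forall G, S G -> (forall i, defect G (Z i) = 0) ->
    defect G W = (la j - la 1) * ip G (u j)].
Proof.
move=> j2; have HD := defect_psd.
have j0 : (0 < j)%N by apply: leq_trans j2.
have Suj := Su j0.
pose c i := (la j - la 1) * a i j.
pose s := \sum_i c i *: Z i.
have Ss : S s by apply: lin_closed_sum Suj _.
have Zu i : defect (u j) (Z i) = c i.
  by rewrite (form_sym HD) defect_eigen.
have Zs i : defect s (Z i) = c i.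
  rewrite (form_sym HD) (form_sumr HS HD)// (bigD1 i)//= ZZ eqxx mulr1 big1 ?addr0//.
  by move=> k ki; rewrite ZZ eq_sym (negbTE ki) mulr0.
pose W := u j - s.
have SW : S W by exact: lin_closedB.
exists W; split => //.
  have WZ i : defect W (Z i) = 0 by rewrite (formBl HD)// Zu Zs subrr.
  rewrite {2}/W (formBr HD)// [X in _ - X](form_sumr HS HD)//.
  rewrite [X in _ - X]big1 ?subr0; last by move=> i _; rewrite WZ mulr0.
  rewrite (formBl HD)// defect_eigen// uu// eqxx (form_sym HD).
  rewrite (form_sumr HS HD)// /bracket mulrBr mulr1; congr (_ - _).
  by rewrite !mulr_sumr; apply: eq_bigr => i _; rewrite Zu /c; ring.
move=> G SG GZ; rewrite (formBr HD)// defect_eigen// (form_sumr HS HD)// big1 ?subr0//.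
by move=> i _; rewrite GZ mulr0.
Qed.

Lemma gap_gt0 j : (2 <= j)%N -> 0 < la j - la 1.
Proof. by move=> j2; rewrite subr_gt0 eigenvalue_gt. Qed.

Lemma bracket_ge0 j : (2 <= j)%N -> 0 <= bracket j.
Proof.
move=> j2; have [W [SW WW _]] := coordinate_residual j2.
by have := form_ge0 defect_psd SW; rewrite WW pmulr_rge0// gap_gt0.
Qed.

(** The bound with 1 in place of [bracket j] is Bessel's inequality; the gain comes
    from testing G against the residual of u j only. *)
Lemma defect_coef G j : (2 <= j)%N -> S G -> (forall i, defect G (Z i) = 0) ->
  ip G (u j) ^+ 2 <= defect G G * (bracket j / (la j - la 1)).
Proof.
move=> j2 SG GZ; have [W [SW WW GW]] := coordinate_residual j2.
have d0 := gap_gt0 j2.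
have := form_cauchy_schwarz HS defect_psd SG SW; rewrite GW// WW exprMn.
move=> h; rewrite -(ler_pM2l (exprn_gt0 2 d0)); apply: le_trans h _.
rewrite le_eqVlt; apply/orP; left; apply/eqP; field.
by rewrite gt_eqF.
Qed.

Let partial_bracket j := 1 - (la j - la 1) *
  \sum_(i < n | (i.+1 <= minn j.-1 n)%N) a i j ^+ 2.

Lemma bracket_le j : (2 <= j)%N -> bracket j <= partial_bracket j.
Proof.
move=> j2; rewrite lerD2l lerN2 ler_pM2l ?gap_gt0//.
rewrite [leRHS](bigID (fun i : 'I_n => (i.+1 <= minn j.-1 n)%N))/=.
by rewrite lerDl sumr_ge0// => i _; exact: sqr_ge0.
Qed.

Let den l := 1 + \sum_(2 <= j < l.+1)
  (la l.+1 - la j) / (la j - la 1) * partial_bracket j.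

Let den_gt0 l : 0 < den l.
Proof.
apply: (lt_le_trans ltr01); rewrite lerDl big_nat sumr_ge0// => j /andP[j2 jl].
apply: mulr_ge0; last exact: le_trans (bracket_ge0 j2) (bracket_le j2).
by rewrite divr_ge0 ?(ltW (gap_gt0 j2))// subr_ge0 eigenvalue_le ?(ltnW j2)// ltnW.
Qed.

Lemma sigma_gt l : (0 < l)%N -> la 1 < sigma_coef la a l.
Proof. by move=> l0; rewrite ltrDl divr_gt0 ?gap_gt0//; exact: den_gt0. Qed.

Lemma sigma_gap G l : S G -> ip G (u 1) = 0 ->
  (forall i, defect G (Z i) = 0) ->
  (sigma_coef la a l - la 1) * ip G G <= defect G G.
Proof.
move=> SG G1 GZ.
rewrite -[sigma_coef la a l]/(la 1 + (la l.+1 - la 1) / den l).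
rewrite addrAC subrr add0r mulrAC ler_pdivrMr ?den_gt0//.
apply: le_trans (defect_gap l SG G1) _.
rewrite /den mulrDr mulr1 lerD2l mulr_sumr !big_nat; apply: ler_sum => j /andP[j2 jl].
have h1 : 0 <= la l.+1 - la j.
  by rewrite subr_ge0 eigenvalue_le ?(ltnW j2)// ltnW.
apply: le_trans (ler_wpM2l h1 (defect_coef j2 SG GZ)) _.
rewrite mulrCA ler_wpM2l ?(form_ge0 defect_psd)// mulrA mulrAC ler_wpM2l ?bracket_le//.
by rewrite divr_ge0 ?(ltW (gap_gt0 j2)).
Qed.

End coordinates.
End spectral.
End forms.

(** * Orthogonal triangularization *)

Section triangular.
Context {R : rcfType} (n : nat).
Implicit Types (v w : 'rV[R]_n).

Definition dot v w : R := \sum_k v ord0 k * w ord0 k.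

Lemma dotC v w : dot v w = dot w v.
Proof. by apply: eq_bigr => k _; rewrite mulrC. Qed.

Lemma dotZl (c : R) v w : dot (c *: v) w = c * dot v w.
Proof. by rewrite /dot mulr_sumr; apply: eq_bigr => k _; rewrite mxE mulrA. Qed.

Lemma dot_gt0 v : v != 0 -> 0 < dot v v.
Proof.
move=> v0; have ge0 k : 0 <= v ord0 k * v ord0 k by rewrite -expr2 sqr_ge0.
rewrite lt_def sumr_ge0 ?andbT//; apply: contra v0 => /eqP s0.
apply/eqP/rowP => k; rewrite mxE; apply/eqP.
have /psumr_eq0P/(_ s0)/(_ k isT)/eqP : forall k, true -> 0 <= v ord0 k * v ord0 k by [].
by rewrite mulf_eq0 orbb.
Qed.

(** The matrix with columns w i becomes singular when its column i0 is replaced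
    by 0. *)
Lemma unit_normal (w : 'I_n -> 'rV[R]_n) (i0 : 'I_n) :
  exists v, dot v v = 1 /\ forall i, i != i0 -> dot v (w i) = 0.
Proof.
pose C : 'M[R]_n := \matrix_(j, i) (if i == i0 then 0 else w i ord0 j).
have /eqP/det0P[v v0 vC] : \det C = 0.
  by rewrite (expand_det_col _ i0) big1// => k _; rewrite mxE eqxx mul0r.
have vv := dot_gt0 v0.
exists ((Num.sqrt (dot v v))^-1 *: v); split.
  rewrite dotZl dotC dotZl mulrA -invfM -expr2 sqr_sqrtr ?ltW// mulVf//.
  by rewrite gt_eqF.
move=> i ii; rewrite dotZl; apply/eqP; rewrite mulf_eq0; apply/orP; right.
have /rowP/(_ i) := vC; rewrite !mxE => e; rewrite -e; apply/eqP.
by apply: eq_bigr => k _; rewrite mxE (negbTE ii).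
Qed.

(** The rows are chosen from the last one to the first: the row of index i has
    to be normal to the i first columns of b and to the n - 1 - i later rows. *)
Lemma orthogonal_triangularization (b : 'M[R]_n) : exists q : 'M[R]_n,
  q *m q^T = 1%:M /\ forall i j : 'I_n, (j < i)%N -> (q *m b) i j = 0.
Proof.
suff [q [q1 q2]] : exists q : 'I_n -> 'rV[R]_n,
    (forall i j, dot (q i) (q j) = (i == j)%:R) /\
    forall i j : 'I_n, (j < i)%N -> dot (q i) (col j b)^T = 0.
  exists (\matrix_(i, k) q i ord0 k); split.
    apply/matrixP => i j; rewrite !mxE -q1; apply: eq_bigr => k _.
    by rewrite !mxE.
  move=> i j ji; rewrite mxE -[RHS](q2 i j ji); apply: eq_bigr => k _.
  by rewrite !mxE.
suff H k : (k <= n)%N -> exists q : 'I_n -> 'rV[R]_n,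
    (forall i j : 'I_n, (n - k <= i)%N -> (n - k <= j)%N ->
       dot (q i) (q j) = (i == j)%:R) /\
    forall i j : 'I_n, (n - k <= i)%N -> (j < i)%N -> dot (q i) (col j b)^T = 0.
  have [q [q1 q2]] := H n (leqnn n).
  by exists q; split => [i j|i j]; [apply: q1|apply: q2]; rewrite subnn.
elim: k => [_|k IH kn].
  by exists (fun=> 0); split => [i j|i j]; rewrite subn0 leqNgt ltn_ord.
have [q [q1 q2]] := IH (ltnW kn).
have i0n : (n - k.+1 < n)%N by lia.
pose i0 := Ordinal i0n.
pose w (i : 'I_n) := if (i < i0)%N then (col i b)^T else q i.
have [v [v1 vw]] := unit_normal w i0.
have vq (j : 'I_n) : (n - k.+1 <= j)%N -> j != i0 -> (n - k <= j)%N /\ dot v (q j) = 0.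
  move=> ij ji; have ij' : (n - k <= j)%N.
    by move: ij ji; rewrite -val_eqE /=; lia.
  split => //; have := vw j ji; rewrite /w ifF//=.
  by apply/negbTE; rewrite -leqNgt.
exists (fun i => if i == i0 then v else q i); split => [i j ii ij|i j ii ji].
  case: (eqVneq i i0) ii => [->|ni] ii; case: (eqVneq j i0) ij => [je|nj] ij //.
  - by have [_ ->] := vq j ij nj.
  - by rewrite je (negbTE ni) dotC; have [_ ->] := vq i ii ni.
  - by have [h1 _] := vq i ii ni; have [h2 _] := vq j ij nj; exact: q1.
have [ie|ni] := eqVneq i i0.
  have := vw j; rewrite /w -ie ji; apply.
  by rewrite -val_eqE /= neq_ltn ji.
by have [h1 _] := vq i ii ni; exact: q2.
Qed.

End triangular.

(** * Test functions *)

Section test_functions.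
Context {R : realType} (n : nat) (Om : set 'rV[R]_n) (B : R).
Hypotheses (oOm : open Om) (B0 : 0 <= B) (OmB : Om `<=` box n B).
Implicit Types (f g G : 'rV[R]_n -> R) (i j : 'I_n).
Local Notation mu := (lebesgue_rV n).

Let mOm : measurable Om := measurable_dom oOm.
Let fOm : (mu Om < +oo)%E := lebesgue_dom oOm B0 OmB.

Local Notation H10 := (@H10 R n Om).

Definition ip f g : R := integral_on Om (fun x => f x * g x).

Definition energy f g : R := \sum_i ip (partial i f) (partial i g).

Lemma eq_square_integrable f g : (forall x, Om x -> f x = g x) ->
  square_integrable Om f -> square_integrable Om g.
Proof.
move=> fg [mf f2]; split.
  by apply: eq_measurable_fun mf => x; rewrite inE; exact: fg.
by apply: eq_integrable f2 => // x; rewrite inE => Ox; rewrite fg.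
Qed.

Lemma eq_ip f f' g g' : (forall x, Om x -> f x = f' x) ->
  (forall x, Om x -> g x = g' x) -> ip f g = ip f' g'.
Proof. by move=> ff gg; apply: eq_Rintegral => x; rewrite inE => Ox; rewrite ff ?gg. Qed.

Lemma ipC f g : ip f g = ip g f.
Proof. by apply: eq_Rintegral => x _; rewrite mulrC. Qed.

Lemma ip_psd : psd_form (square_integrable Om) ip.
Proof.
split; first exact: ipC.
- move=> a b f g h sf sg sh.
  have fh := square_integrable_mul mOm sf sh.
  have gh := square_integrable_mul mOm sg sh.
  rewrite /ip /integral_on -!RintegralZl// -RintegralD//; last 2 first.
  + exact: (integrableZl mOm a fh).
  + exact: (integrableZl mOm b gh).
  apply: eq_Rintegral => x _.
  by rewrite -[(a *: f + b *: g) x]/(a * f x + b * g x) mulrDl !mulrA.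
- by move=> f _; apply: Rintegral_ge0 => x _; rewrite -expr2 sqr_ge0.
Qed.

Lemma square_integrable_lin_closed : lin_closed (square_integrable Om).
Proof. by move=> a b f g; exact: square_integrable_lin. Qed.

Lemma H10_square_integrable G : H10 G -> square_integrable Om G.
Proof.
move=> [CG vG _]; have [C CP] := vanishing_bounded oOm OmB CG vG.
exact: (square_integrable_bounded mOm fOm (class_C_measurable oOm CG) CP).
Qed.

Lemma H10_lin_closed : lin_closed H10.
Proof.
move=> a b f g [Cf vf sf] [Cg vg sg]; split.
- exact: class_C1_lin.
- exact: vanishing_lin.
- move=> i; apply: eq_square_integrable (square_integrable_lin mOm a b (sf i) (sg i)).
  by move=> x Ox; rewrite (partial_lin _ _ _ Cf Cg).
Qed.

Lemma H10_ip_psd : psd_form H10 ip.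
Proof.
have [h1 h2 h3] := ip_psd; split => //.
- by move=> a b f g h Hf Hg Hh; apply: h2; exact: H10_square_integrable.
- by move=> f Hf; apply: h3; exact: H10_square_integrable.
Qed.

Lemma H10_energy_psd : psd_form H10 energy.
Proof.
have [h1 h2 h3] := ip_psd; split.
- by move=> f g; apply: eq_bigr => i _; exact: h1.
- move=> a b f g h [Cf _ sf] [Cg _ sg] [_ _ sh].
  rewrite /energy !mulr_sumr -big_split/=; apply: eq_bigr => i _.
  rewrite -(h2 a b (partial i f) (partial i g) (partial i h))//.
  by apply: eq_ip => // x Ox; rewrite (partial_lin _ _ _ Cf Cg).
- by move=> f [_ _ sf]; apply: sumr_ge0 => i _; exact: h3.
Qed.

Lemma coord_bounded j x : Om x -> `|x ord0 j| <= B.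
Proof. by move=> Ox; exact: (OmB Ox). Qed.

Lemma measurable_coord j : measurable_fun Om (fun x : 'rV[R]_n => x ord0 j).
Proof. exact: (class_C_measurable oOm (class_C1_coord oOm j)). Qed.

Lemma within_coord_continuous j :
  {within closure Om, continuous (fun x : 'rV[R]_n => x ord0 j)}.
Proof. by apply: continuous_subspaceT => x; exact: coord_continuous. Qed.

Lemma partial_coord_mul i j G x : class_C 1 Om G -> Om x ->
  partial i (fun x : 'rV[R]_n => x ord0 j * G x) x = (i == j)%:R * G x + x ord0 j * partial i G x.
Proof.
by move=> CG Ox; rewrite (partial_mul i (class_C1_coord oOm j) CG Ox) partial_coord.
Qed.

Lemma H10_coord_mul j G : H10 G -> H10 (fun x : 'rV[R]_n => x ord0 j * G x).
Proof.
move=> HG; have [CG vG sG] := HG; have Cj := class_C1_coord oOm j; split.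
- exact: class_C1_mul.
- by apply: vanishing_mul => //; exact: within_coord_continuous.
- move=> i; apply: (@eq_square_integrable
    ((i == j)%:R *: G + 1 *: (fun x : 'rV[R]_n => x ord0 j * partial i G x))).
    by move=> x Ox; rewrite partial_coord_mul// -[LHS]/(_ * _ + 1 * _) mul1r.
  apply: square_integrable_lin_closed; first exact: H10_square_integrable.
  apply: (square_integrable_bounded_mul mOm _ (fun x => @coord_bounded j x)) => //.
  exact: measurable_coord.
Qed.

Lemma continuous_itv_bounded (h : R -> R) (C : R) : continuous h ->
  exists M, forall s, `|s| <= C -> `|h s| <= M.
Proof.
move=> ch; have /compact_bounded[M [_ MP]] : compact (h @` `[- C, C]).
  by apply: continuous_compact; [exact: continuous_subspaceT|exact: segment_compact].
exists (`|M| + 1) => s sC; apply: MP; first by rewrite ltr_pwDr// ler_norm.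
by exists s => //; rewrite /= in_itv/= -ler_norml.
Qed.

Lemma H10_comp G (h h' : R -> R) :
  (forall s : R, is_derive s (1 : R) h (h' s)) -> continuous h' -> h 0 = 0 ->
  H10 G -> H10 (h \o G).
Proof.
move=> dh ch' h0 [CG vG sG].
have ch : continuous h.
  by move=> s; apply/differentiable_continuous/derivable1_diffP; case: (dh s).
split.
- exact: (class_C1_comp oOm dh).
- exact: vanishing_comp.
- have [C CP] := vanishing_bounded oOm OmB CG vG.
  have [M MP] := continuous_itv_bounded C ch'.
  move=> i; apply: (@eq_square_integrable (fun x => (h' \o G) x * partial i G x)).
    by move=> x Ox; rewrite (partial_comp i dh CG Ox).
  apply: (square_integrable_bounded_mul mOm (C := M)) => //; last first.
    by move=> x Ox; apply: MP; exact: CP.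
  apply: open_continuous_measurable_rV => // x Ox; apply: for_continuous_comp => //.
  exact: (class_C_continuous CG Ox).
Qed.

Lemma ip_by_parts i f g : H10 f -> H10 g ->
  ip (partial i f) g + ip f (partial i g) = 0.
Proof.
move=> Hf Hg; have [Cf vf sf] := Hf; have [Cg vg sg] := Hg.
have sf0 := H10_square_integrable Hf; have sg0 := H10_square_integrable Hg.
have i1 := square_integrable_mul mOm (sf i) sg0.
have i2 := square_integrable_mul mOm sf0 (sg i).
rewrite /ip /integral_on -RintegralD//.
have E x : Om x -> partial i (fun x => f x * g x) x =
    partial i f x * g x + f x * partial i g x by exact: partial_mul.
transitivity (integral_on Om (partial i (fun x => f x * g x))).
  by apply: eq_Rintegral => x; rewrite inE => Ox; rewrite E.
apply: (integral_partial0 oOm B0 OmB).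
- exact: class_C1_mul.
- by apply: vanishing_mul => //; case: vf.
- apply: eq_integrable (integrableD mOm i1 i2) => // x.
  by rewrite inE => Ox /=; rewrite E.
Qed.

Section eigenfunction.
Context (v : 'rV[R]_n -> R) (la : R).
Hypotheses (Hv : H10 v) (vE : forall G, H10 G -> energy G v = la * ip G v).

Let sv : square_integrable Om v := H10_square_integrable Hv.
Let Cv : class_C 1 Om v. Proof. by case: Hv. Qed.
Let sdv i : square_integrable Om (partial i v). Proof. by case: Hv. Qed.

Let xv j : 'rV[R]_n -> R := fun x => x ord0 j * v x.

(** Moving the factor x_j from one gradient to the other costs two terms that
    contain d_j only; the eigenvalue equation is then applied to x_j G. *)
Lemma energy_coord_mul j G : H10 G ->
  energy (xv j) G - la * ip (xv j) G = - 2 * ip G (partial j v).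
Proof.
move=> HG; have [CG vG sG] := HG; have sG0 := H10_square_integrable HG.
have HxG := H10_coord_mul j HG.
have sx f : square_integrable Om f -> square_integrable Om (fun x : 'rV[R]_n => x ord0 j * f x).
  move=> sf; apply: (square_integrable_bounded_mul mOm _ (fun x => @coord_bounded j x)) => //.
  exact: measurable_coord.
pose T := \sum_i ip (fun x : 'rV[R]_n => x ord0 j * partial i v x) (partial i G).
have pick (F : 'I_n -> R) : \sum_i (i == j)%:R * F i = F j.
  rewrite (bigD1 j)//= eqxx mul1r big1 ?addr0// => i /negbTE ->.
  by rewrite mul0r.
have E1 : energy (xv j) G = ip v (partial j G) + T.
  rewrite -(pick (fun i => ip v (partial i G))) -big_split/=.
  apply: eq_bigr => i _; rewrite -[X in _ + X]mul1r.
  rewrite -(form_lin ip_psd) //; last exact: sx.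
  apply: eq_ip => // x Ox; rewrite (partial_coord_mul _ _ Cv)//.
  by rewrite -[RHS]/(_ * _ + 1 * _) mul1r.
have E2 : energy (fun x : 'rV[R]_n => x ord0 j * G x) v = ip G (partial j v) + T.
  rewrite -(pick (fun i => ip G (partial i v))) -big_split/=.
  apply: eq_bigr => i _; rewrite -[X in _ + X]mul1r.
  have -> : ip (fun x : 'rV[R]_n => x ord0 j * partial i v x) (partial i G) =
            ip (fun x : 'rV[R]_n => x ord0 j * partial i G x) (partial i v).
    by apply: eq_Rintegral => x _; ring.
  rewrite -(form_lin ip_psd) //; last exact: sx.
  apply: eq_ip => // x Ox; rewrite (partial_coord_mul _ _ CG)//.
  by rewrite -[RHS]/(_ * _ + 1 * _) mul1r.
have := vE HxG; rewrite E2.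
have -> : ip (fun x : 'rV[R]_n => x ord0 j * G x) v = ip (xv j) G.
  by apply: eq_Rintegral => x _; rewrite /xv; ring.
move=> <-; rewrite E1; have := ip_by_parts j Hv HG.
rewrite (ipC (partial j v) G).
by move: (ip v (partial j G)) (ip G (partial j v)) T {E1 E2} => s t T' /=; lra.
Qed.

Lemma ip_coord_partial i k f : H10 f ->
  ip (fun x : 'rV[R]_n => x ord0 k * f x) (partial i f) = - 2^-1 * (i == k)%:R * ip f f.
Proof.
move=> Hf; have [Cf vf sf] := Hf; have sf0 := H10_square_integrable Hf.
have := ip_by_parts i (H10_coord_mul k Hf) Hf.
have sx g : square_integrable Om g -> square_integrable Om (fun x : 'rV[R]_n => x ord0 k * g x).
  move=> sg; apply: (square_integrable_bounded_mul mOm _ (fun x => @coord_bounded k x)) => //.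
  exact: measurable_coord.
have -> : ip (partial i (fun x : 'rV[R]_n => x ord0 k * f x)) f =
    (i == k)%:R * ip f f + 1 * ip (fun x : 'rV[R]_n => x ord0 k * partial i f x) f.
  rewrite -(form_lin ip_psd)//; last exact: sx.
  apply: eq_ip => // x Ox; rewrite (partial_coord_mul _ _ Cf)//.
  by rewrite -[RHS]/(_ * _ + 1 * _) mul1r.
have -> : ip (fun x : 'rV[R]_n => x ord0 k * partial i f x) f =
    ip (fun x : 'rV[R]_n => x ord0 k * f x) (partial i f).
  by apply: eq_Rintegral => x _; ring.
by move: (ip _ (partial i f)) (ip f f) => s t; lra.
Qed.

End eigenfunction.
End test_functions.

(** * Signed powers of the first eigenfunction *)

Section power.
Context {R : realType} (n : nat) (Om : set 'rV[R]_n) (B : R).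
Hypotheses (oOm : open Om) (B0 : 0 <= B) (OmB : Om `<=` box n B).
Implicit Types (f g G : 'rV[R]_n -> R) (i j : 'I_n).
Local Notation mu := (lebesgue_rV n).
Local Notation ip := (ip Om).
Local Notation energy := (energy Om).

Let mOm : measurable Om := measurable_dom oOm.
Let fOm : (mu Om < +oo)%E := lebesgue_dom oOm B0 OmB.

Context (v : 'rV[R]_n -> R) (la : R).
Hypotheses (Hv : H10 Om v) (vE : forall G, H10 Om G -> energy G v = la * ip G v).
Hypothesis v1 : ip v v = 1.

Definition signed_power (r : R) f (x : 'rV[R]_n) : R := f x * `|f x| `^ r.

Lemma H10_signed_power r : 0 < r -> H10 Om (signed_power r v).
Proof.
move=> r0.
have d (s : R) := is_derive_signed_powR s r0.
have c : continuous (fun s : R => (r + 1) * `|s| `^ r).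
  move=> s; exact: (@for_continuousM R R (cst (r + 1)) (fun s => `|s| `^ r) s
    (@cst_continuous _ _ _ s) (@abs_powR_continuous _ r r0 s)).
apply: (H10_comp oOm OmB d c _ Hv); exact: mul0r.
Qed.

Lemma partial_signed_power r i x : 0 < r -> Om x ->
  partial i (signed_power r v) x = (r + 1) * `|v x| `^ r * partial i v x.
Proof.
move=> r0 Ox; case: Hv => Cv _ _.
exact: (partial_comp i (fun s => is_derive_signed_powR s r0) Cv Ox).
Qed.

Lemma ipZl c f g : square_integrable Om f -> square_integrable Om g ->
  ip (fun x => c * f x) g = c * ip f g.
Proof.
move=> sf sg; rewrite /ip /integral_on -RintegralZl//.
  by apply: eq_Rintegral => x _; rewrite mulrA.
exact: square_integrable_mul.
Qed.

Let sv := H10_square_integrable oOm B0 OmB Hv.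

Let sdv i : square_integrable Om (partial i v). Proof. by case: Hv. Qed.

Section exponent.
Context (r : R) (r0 : 0 < r).
Let phi := signed_power r v.
Let Hphi : H10 Om phi := H10_signed_power r0.
Let sphi := H10_square_integrable oOm B0 OmB Hphi.
Let sdphi i : square_integrable Om (partial i phi). Proof. by case: Hphi. Qed.

(** phi d_i v is a multiple of the i-th derivative of |v|^(r + 2). *)
Lemma ip_signed_power_partial i : ip phi (partial i v) = 0.
Proof.
have := ip_by_parts oOm B0 OmB i Hphi Hv.
have -> : ip (partial i phi) v = (r + 1) * ip phi (partial i v).
  rewrite -ipZl; [|exact: sphi|exact: sdv].
  apply: eq_Rintegral => x; rewrite inE => Ox.
  by rewrite (partial_signed_power _ r0 Ox) /phi /signed_power; ring.
have r2 : r + 1 + 1 != 0 by rewrite gt_eqF// !addr_gt0.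
by rewrite -[X in _ + X]mul1r -mulrDl => /eqP; rewrite mulf_eq0 (negbTE r2) => /eqP.
Qed.

Lemma ip_partial_signed_power i : ip v (partial i phi) = 0.
Proof.
have := ip_by_parts oOm B0 OmB i Hv Hphi.
by rewrite ipC ip_signed_power_partial add0r.
Qed.

(** Same primitive as above, multiplied by a coordinate. *)
Lemma ip_coord_partial_signed_power k i :
  ip (fun x : 'rV[R]_n => x ord0 k * v x) (partial i phi) =
  - ((r + 1) / (r + 2)) * ((i == k)%:R * ip phi v).
Proof.
have Hx := H10_coord_mul oOm B0 OmB k Hphi.
have sx := H10_square_integrable oOm B0 OmB Hx.
set X := LHS.
have XE : X = (r + 1) * ip (fun x : 'rV[R]_n => x ord0 k * phi x) (partial i v).
  rewrite -ipZl; [|exact: sx|exact: sdv].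
  apply: eq_Rintegral => x; rewrite inE => Ox.
  by rewrite (partial_signed_power _ r0 Ox) /phi /signed_power; ring.
have sxd : square_integrable Om (fun x : 'rV[R]_n => x ord0 k * partial i phi x).
  apply: (square_integrable_bounded_mul mOm _ (coord_bounded OmB k)) => //.
  exact: measurable_coord.
have E : ip (partial i (fun x : 'rV[R]_n => x ord0 k * phi x)) v =
    (i == k)%:R * ip phi v + 1 * X.
  have -> : X = ip (fun x : 'rV[R]_n => x ord0 k * partial i phi x) v.
    by apply: eq_Rintegral => x _; ring.
  rewrite -(form_lin (ip_psd oOm))//; apply: eq_ip => // x Ox.
  rewrite (partial_coord_mul oOm); [|by case: Hphi|by []].
  by rewrite -[RHS]/(_ * _ + 1 * _) mul1r.
(* e is a linear equation for X, because the second term is X / (r + 1) *)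
have := ip_by_parts oOm B0 OmB i Hx Hv; rewrite E mul1r => e.
have r1 : r + 1 != 0 by rewrite gt_eqF// !addr_gt0.
have r2 : r + 2 != 0 by rewrite gt_eqF// !addr_gt0.
have {}e : (i == k)%:R * ip phi v + X + X / (r + 1) = 0.
  by rewrite -[RHS]e; congr (_ + _); rewrite XE; field.
have -> : (i == k)%:R * ip phi v = - ((r + 2) / (r + 1)) * X.
  by apply/eqP; rewrite -subr_eq0 -e; apply/eqP; field.
by field; rewrite r1.
Qed.

End exponent.

(** Up to a constant, both sides are the energy between v and v |v|^(2 r), and v
    is an eigenfunction. *)
Lemma energy_signed_power r : 0 < r ->
  energy (signed_power r v) (signed_power r v) =
  (r + 1) ^+ 2 / (2 * r + 1) * (la * ip (signed_power r v) (signed_power r v)).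
Proof.
move=> r0; have r20 : 0 < r * 2 by rewrite mulr_gt0.
have pw x : `|v x| `^ (r * 2) = (`|v x| `^ r) ^+ 2.
  by rewrite powRrM powR_mulrn// powR_ge0.
have -> : ip (signed_power r v) (signed_power r v) = ip (signed_power (r * 2) v) v.
  by apply: eq_Rintegral => x _; rewrite /signed_power pw; ring.
have H2 := H10_signed_power r20.
rewrite -vE// /energy mulr_sumr; apply: eq_bigr => i _.
have r2 : 2 * r + 1 != 0 by rewrite gt_eqF// addr_gt0// mulr_gt0.
rewrite -ipZl; [|by case: H2|exact: sdv].
apply: eq_Rintegral => x; rewrite inE => Ox.
rewrite (partial_signed_power i r0 Ox) (partial_signed_power i r20 Ox) pw.
by field.
Qed.

(** Where |v| is small, v^2 is not controlled by |v|^(r + 2); but the small values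
    of v contribute little to the integral of v^2, which is 1. *)
Lemma ip_signed_power_gt0 r : 0 < r -> 0 < ip (signed_power r v) v.
Proof.
move=> r0; set m := ip _ _.
have sphi := H10_square_integrable oOm B0 OmB (H10_signed_power r0).
have iphi := square_integrable_mul mOm sphi sv.
pose V := fine (mu Om); have V0 : 0 <= V by exact: fine_ge0.
(* the threshold between small and large values of v: d ^+ 2 * V < 1 *)
pose d := (V + 1)^-1; have d0 : 0 < d by rewrite invr_gt0 ltr_wpDl.
have dr : 0 < d `^ r by rewrite powR_gt0.
have bound x : v x * v x <= d ^+ 2 + (d `^ r)^-1 * (signed_power r v x * v x).
  have -> : signed_power r v x * v x = v x ^+ 2 * `|v x| `^ r.
    by rewrite /signed_power; ring.
  rewrite -expr2; have [vd|dv] := leP `|v x| d.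
    rewrite -[leLHS]addr0 lerD//; last first.
      by rewrite mulr_ge0 ?invr_ge0 ?powR_ge0// mulr_ge0 ?sqr_ge0 ?powR_ge0.
    by rewrite -real_normK ?num_real// lerXn2r// nnegrE// ltW.
  rewrite -[leLHS]add0r lerD ?sqr_ge0// mulrCA ler_peMr ?sqr_ge0//.
  rewrite mulrC ler_pdivlMr// mul1r; apply: ge0_ler_powR; rewrite ?nnegrE//; exact: ltW.
have i1 : mu.-integrable Om (EFin \o (fun x => d ^+ 2)).
  apply: (bounded_integrable oOm B0 OmB (C := `|d ^+ 2|)) => // x _.
  exact: cst_continuous.
have i2 : mu.-integrable Om (EFin \o (fun x => (d `^ r)^-1 * (signed_power r v x * v x))).
  exact: (integrableZl mOm _ iphi).
have : 1 <= d ^+ 2 * V + (d `^ r)^-1 * m.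
  rewrite -v1 /m /ip /integral_on -RintegralZl// -[d ^+ 2 * V]Rintegral_cst//.
  rewrite -RintegralD//; apply: le_Rintegral => //.
  - exact: square_integrable_mul.
  - exact: (integrableD mOm i1 i2).
have dV : d ^+ 2 * V < 1.
  have dV1 : d * V < 1 by rewrite mulrC ltr_pdivrMr ?ltr_wpDl// mul1r ltrDl.
  apply: le_lt_trans dV1; rewrite expr2 -mulrA ler_piMl// ?mulr_ge0// ?(ltW d0)//.
  by rewrite invf_le1 ?ltr_wpDl// lerDr.
move=> h; have : 0 < (d `^ r)^-1 * m by lra.
by rewrite pmulr_rgt0// invr_gt0.
Qed.

End power.

(** * Cartesian coordinates times the first eigenfunction *)

Lemma sum_delta (R : pzRingType) n (i : 'I_n) (F : 'I_n -> R) :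
  \sum_k (k == i)%:R * F k = F i.
Proof.
rewrite (bigD1 i)//= eqxx mul1r big1 ?addr0// => k /negbTE ->.
by rewrite mul0r.
Qed.

(** The hypothesis is an upper bound for M / m ^+ 2, and this value of r minimizes
    the estimate that results from it. *)
Lemma optimal_exponent (R : realType) (la sg M m : R) : 0 < la -> la < sg -> 0 < m ->
  let r := (sg - la) / (sg + la) in
  (sg - la) * (M - m ^+ 2) <= (r + 1) ^+ 2 / (2 * r + 1) * (la * M) - la * M ->
  (r + 2) ^+ 2 / (2 * r + 1) * (la * M) / m ^+ 2 <= 3 * la + la ^+ 2 / sg.
Proof.
move=> la0 sg0 m0 r.
have s0 : 0 < sg by apply: lt_trans sg0.
have s1 : 0 < sg + la by rewrite addr_gt0.
have s2 : 0 < 3 * sg - la by lra.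
have s3 : 0 < 3 * sg + la by lra.
have s4 : 0 < sg - la by rewrite subr_gt0.
have n1 : sg + la != 0 by rewrite gt_eqF.
have n2 : 3 * sg - la != 0 by rewrite gt_eqF.
have n3 : 3 * sg + la != 0 by rewrite gt_eqF.
have n4 : sg != 0 by rewrite gt_eqF.
have n5 : sg - la != 0 by rewrite gt_eqF.
have n6 : m != 0 by rewrite gt_eqF.
have -> : (r + 1) ^+ 2 / (2 * r + 1) = 4 * sg ^+ 2 / ((sg + la) * (3 * sg - la)).
  by rewrite /r; field; repeat (apply/andP; split); apply: lt0r_neq0; lra.
have -> : (r + 2) ^+ 2 / (2 * r + 1) =
    (3 * sg + la) ^+ 2 / ((sg + la) * (3 * sg - la)).
  by rewrite /r; field; repeat (apply/andP; split); apply: lt0r_neq0; lra.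
move=> h.
have hM : M <= m ^+ 2 * ((sg + la) * (3 * sg - la)) / (sg * (3 * sg + la)).
  rewrite ler_pdivlMr ?mulr_gt0// -subr_ge0.
  rewrite -subr_ge0 in h.
  have e : 4 * sg ^+ 2 / ((sg + la) * (3 * sg - la)) * (la * M) - la * M -
      (sg - la) * (M - m ^+ 2) =
      (m ^+ 2 * ((sg + la) * (3 * sg - la)) - M * (sg * (3 * sg + la))) *
      ((sg - la) / ((sg + la) * (3 * sg - la))).
    by field; rewrite n1 n2.
  by move: h; rewrite e pmulr_lge0// divr_gt0// mulr_gt0.
have -> : 3 * la + la ^+ 2 / sg =
   (3 * sg + la) ^+ 2 / ((sg + la) * (3 * sg - la)) *
   (la * (m ^+ 2 * ((sg + la) * (3 * sg - la)) / (sg * (3 * sg + la)))) / m ^+ 2.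
  by field; rewrite n1 n2 n3 n4 n6.
rewrite ler_pM2r ?invr_gt0 ?exprn_gt0// ler_pM2l ?ler_pM2l//.
by rewrite divr_gt0 ?exprn_gt0// mulr_gt0.
Qed.

Section coordinates.
Context {R : realType} (n : nat) (Om : set 'rV[R]_n) (B : R).
Hypotheses (oOm : open Om) (B0 : 0 <= B) (OmB : Om `<=` box n B).
Implicit Types (f g G : 'rV[R]_n -> R) (i j : 'I_n).
Local Notation ip := (ip Om).
Local Notation energy := (energy Om).

Context (v : 'rV[R]_n -> R) (la : R).
Hypotheses (Hv : H10 Om v) (vE : forall G, H10 Om G -> energy G v = la * ip G v).
Hypothesis v1 : ip v v = 1.
Context (q : 'M[R]_n) (c : 'I_n -> R).
Hypothesis qq : q *m q^T = 1%:M.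

Definition coord_mul j : 'rV[R]_n -> R := fun x => x ord0 j * v x.

Definition rotated_coord_mul i : 'rV[R]_n -> R :=
  (\sum_j q i j *: coord_mul j) - c i *: v.

Local Notation Z := rotated_coord_mul.

Let HS := @H10_lin_closed R n Om oOm.
Let HP := H10_ip_psd oOm B0 OmB.

Let D f g := energy f g - la * ip f g.

Lemma rotated_coord_mulE i x :
  Z i x = (\sum_j q i j * x ord0 j - c i) * v x.
Proof.
rewrite -[LHS]/((\sum_j q i j *: coord_mul j) x - c i * v x) mulrBl.
congr (_ - _); rewrite fct_sumE mulr_suml; apply: eq_bigr => j _.
by rewrite -[LHS]/(q i j * (x ord0 j * v x)) mulrA.
Qed.

Lemma H10_coord j : H10 Om (coord_mul j). Proof. exact: (H10_coord_mul oOm B0 OmB). Qed.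

Let HX i : H10 Om (\sum_j q i j *: coord_mul j).
Proof.
exact: (@lin_closed_sum _ _ (H10 Om) _ _ predT _ _ v HS Hv (fun j _ => H10_coord j)).
Qed.

Let Hcv i : H10 Om (c i *: v).
Proof. by have := HS (c i) 0 Hv Hv; rewrite scale0r addr0. Qed.

Lemma H10_rotated i : H10 Om (Z i).
Proof. exact: lin_closedB. Qed.

(** Stated for an arbitrary form because it serves for ip on square-integrable
    functions as well as for ip and the defect form on test functions. *)
Lemma form_rotated (S : ('rV[R]_n -> R) -> Prop) (F : _ -> _ -> R) i G :
  lin_closed S -> psd_form S F -> (forall j, S (coord_mul j)) -> S v -> S G ->
  F (Z i) G = \sum_j q i j * F (coord_mul j) G - c i * F v G.
Proof.
move=> HS' HF Sx Sv SG.
have SX : S (\sum_j q i j *: coord_mul j) by exact: (@lin_closed_sum _ _ S _ _ predT _ _ v HS' Sv (fun j _ => Sx j)).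
have Scv : S (c i *: v) by have := HS' (c i) 0 _ _ Sv Sv; rewrite scale0r addr0.
rewrite (formBl HF)// (form_sym HF) (form_sumr HS' HF)//; congr (_ - _).
  by apply: eq_bigr => j _; rewrite (form_sym HF).
have := form_lin HF (c i) 0 Sv Sv SG.
by rewrite scale0r addr0 mul0r addr0.
Qed.

Lemma rowE i k : \sum_j q i j * q k j = (i == k)%:R.
Proof.
have /matrixP/(_ i k) := qq; rewrite !mxE => <-.
by apply: eq_bigr => j _; rewrite mxE.
Qed.

Lemma colE i k : \sum_j q j i * q j k = (i == k)%:R.
Proof.
have /matrixP/(_ i k) := mulmx1C qq; rewrite !mxE => <-.
by apply: eq_bigr => j _; rewrite mxE.
Qed.

Hypothesis D_psd : psd_form (H10 Om) D.

Lemma defect_self G : H10 Om G -> D G v = 0.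
Proof. by move=> HG; rewrite /D vE// subrr. Qed.

Lemma defect_coord j G : H10 Om G -> D (coord_mul j) G = - 2 * ip G (partial j v).
Proof. exact: (energy_coord_mul oOm B0 OmB Hv vE). Qed.

Lemma defect_rotated i G : H10 Om G ->
  D (Z i) G = \sum_j q i j * (- 2 * ip G (partial j v)).
Proof.
move=> HG; rewrite (form_rotated i HS D_psd H10_coord Hv HG).
rewrite (form_sym D_psd v) defect_self// mulr0 subr0.
by apply: eq_bigr => j _; rewrite defect_coord.
Qed.

Lemma defect_rotated_orthonormal i k : D (Z i) (Z k) = (i == k)%:R.
Proof.
rewrite (form_rotated i HS D_psd H10_coord Hv (H10_rotated k)).
rewrite (form_sym D_psd v) (defect_self (H10_rotated k)) mulr0 subr0 -rowE.
apply: eq_bigr => j _; congr (_ * _).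
rewrite (form_sym D_psd) (defect_rotated k (H10_coord j)).
rewrite -[RHS](sum_delta j (fun l => q k l)).
apply: eq_bigr => l _; rewrite (ip_coord_partial oOm B0 OmB l j Hv) v1.
by field.
Qed.

Section power.
Context (r : R) (r0 : 0 < r).
Let phi := signed_power r v.
Let Hphi : H10 Om phi := H10_signed_power oOm OmB Hv r0.
Let sdphi i : square_integrable Om (partial i phi). Proof. by case: Hphi. Qed.
Let m := ip phi v.
Let M := ip phi phi.

Let sv := H10_square_integrable oOm B0 OmB Hv.

Lemma defect_signed_power_rotated i : D phi (Z i) = 0.
Proof.
rewrite (form_sym D_psd) defect_rotated// big1// => j _.
by rewrite (ip_signed_power_partial oOm B0 OmB)// !mulr0.
Qed.

Let dphi i : 'rV[R]_n -> R := \sum_j q i j *: partial j phi.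

Let sdphi' i : square_integrable Om (dphi i).
Proof.
exact: (@lin_closed_sum _ _ (square_integrable Om) _ _ predT _ _ v
  (square_integrable_lin_closed oOm) sv (fun j _ => sdphi j)).
Qed.

Let IP := ip_psd oOm.
Let IS := square_integrable_lin_closed oOm.

Lemma ip_rotated_partial i : ip (Z i) (dphi i) = - ((r + 1) / (r + 2)) * m.
Proof.
have sZ := H10_square_integrable oOm B0 OmB (H10_rotated i).
have sx j := H10_square_integrable oOm B0 OmB (H10_coord j).
rewrite (form_sumr IS IP)//.
have E k : ip (Z i) (partial k phi) = q i k * (- ((r + 1) / (r + 2)) * m).
  rewrite (form_rotated i IS IP sx sv (sdphi k)).
  rewrite (ip_partial_signed_power oOm B0 OmB Hv) // mulr0 subr0.
  rewrite -[RHS](sum_delta k (fun j => q i j * (- ((r + 1) / (r + 2)) * m))).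
  apply: eq_bigr => j _; rewrite (ip_coord_partial_signed_power oOm B0 OmB Hv r0).
  by rewrite -/phi -/m [k == j]eq_sym; ring.
under eq_bigr do rewrite E mulrA.
by rewrite -mulr_suml rowE eqxx mul1r.
Qed.

Lemma sum_ip_rotated_partial : \sum_i ip (dphi i) (dphi i) = energy phi phi.
Proof.
have E i : ip (dphi i) (dphi i) =
    \sum_k \sum_j q i k * q i j * ip (partial k phi) (partial j phi).
  rewrite (form_sumr IS IP)//; apply: eq_bigr => k _.
  rewrite (form_sym IP) (form_sumr IS IP)// mulr_sumr.
  by apply: eq_bigr => j _; rewrite mulrA.
rewrite (eq_bigr _ (fun i _ => E i)) exchange_big/=; apply: eq_bigr => k _.
rewrite exchange_big/= -[RHS](sum_delta k (fun j => ip (partial k phi) (partial j phi))).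
apply: eq_bigr => j _; rewrite -mulr_suml; congr (_ * _).
by rewrite colE eq_sym.
Qed.

(** Cauchy-Schwarz between Z i and the derivative of phi along the i-th axis. *)
Lemma rotated_moment_bound i : 0 < ip (Z i) (Z i) /\
  (ip (Z i) (Z i))^-1 <= ip (dphi i) (dphi i) / ((r + 1) / (r + 2) * m) ^+ 2.
Proof.
have sZ := H10_square_integrable oOm B0 OmB (H10_rotated i).
have := form_cauchy_schwarz IS IP sZ (sdphi' i).
rewrite ip_rotated_partial mulNr sqrrN.
have m0 : 0 < m := ip_signed_power_gt0 oOm B0 OmB Hv v1 r0.
have k0 : 0 < ((r + 1) / (r + 2) * m) ^+ 2.
  by rewrite exprn_gt0// mulr_gt0// divr_gt0// addr_gt0.
move=> h; have I0 : 0 < ip (Z i) (Z i).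
  rewrite lt_def (form_ge0 IP)// andbT; apply/negP => /eqP I0.
  by move: h; rewrite I0 mul0r leNgt k0.
by split => //; rewrite ler_pdivlMr// [leLHS]mulrC ler_pdivrMr// [leRHS]mulrC.
Qed.

(** The squared derivatives along the axes add up to the energy of phi, since q is
    orthogonal. *)
Lemma sum_inverse_moment :
  \sum_i (ip (Z i) (Z i))^-1 <= (r + 2) ^+ 2 / (2 * r + 1) * (la * M) / m ^+ 2.
Proof.
have m0 : 0 < m := ip_signed_power_gt0 oOm B0 OmB Hv v1 r0.
have r1 : r + 1 != 0 by rewrite gt_eqF// addr_gt0.
have r2 : r + 2 != 0 by rewrite gt_eqF// addr_gt0.
have r3 : 2 * r + 1 != 0 by rewrite gt_eqF// addr_gt0// mulr_gt0.
apply: (@le_trans _ _ (\sum_i ip (dphi i) (dphi i) / ((r + 1) / (r + 2) * m) ^+ 2)).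
  by apply: ler_sum => i _; have [] := rotated_moment_bound i.
rewrite -mulr_suml sum_ip_rotated_partial (energy_signed_power oOm OmB Hv vE r0).
rewrite -/phi -/M le_eqVlt; apply/orP; left; apply/eqP; field.
by rewrite r1 r2 r3 gt_eqF.
Qed.

End power.
End coordinates.

(** * The Dirichlet spectrum *)

Lemma bounded_subset_box (R : realType) n (A : set 'rV[R]_n) : bounded_set A ->
  exists2 B, 0 <= B & A `<=` box n B.
Proof.
move=> [M [_ AM]]; exists (`|M| + 1); first by rewrite addr_ge0.
move=> x Ax i; have : `|x| <= `|M| + 1 by apply: AM => //; rewrite ltr_pwDr// ler_norm.
apply: le_trans; rewrite [leRHS]/Num.norm /= mx_normrE.
by apply/bigmax_geP; right => /=; exists (ord0, i).
Qed.

Section spectrum.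
Context {R : realType} (n : nat) (Om : set 'rV[R]_n) (B : R).
Hypotheses (oOm : open Om) (B0 : 0 <= B) (OmB : Om `<=` box n B).
Context (la : nat -> R) (u : nat -> 'rV[R]_n -> R).
Hypothesis spec : dirichlet_spectrum Om la u.
Local Notation ip := (ip Om).
Local Notation energy := (energy Om).

Lemma H10_eigenfunction j : (0 < j)%N -> H10 Om (u j).
Proof.
move=> j0; have [Cu cu lu u0 _] := dirichletP spec j0.
exact: (eigenfunction_H10 oOm B0 OmB Cu lu (conj cu u0)).
Qed.

Lemma energy_eigenfunction j G : (0 < j)%N -> H10 Om G ->
  energy G (u j) = la j * ip G (u j).
Proof.
move=> j0 HG; have [Cu cu lu u0 _] := dirichletP spec j0.
exact: (green_first_identity oOm B0 OmB Cu lu (conj cu u0) HG).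
Qed.

Lemma orthonormal_eigenfunctions j k : (0 < j)%N -> (0 < k)%N ->
  ip (u j) (u k) = (j == k)%:R.
Proof. by case: (dirichlet_basis spec) => _ h _; exact: h. Qed.

Lemma parseval_eigenfunctions G : square_integrable Om G ->
  \sum_(1 <= j < N.+1) ip G (u j) ^+ 2 @[N --> \oo] --> ip G G.
Proof.
move=> sG; have [su _ dense] := dirichlet_basis spec.
have E N : \sum_(1 <= j < N.+1) ip G (u j) ^+ 2 = ip G G -
    integral_on Om (fun x => (G x - \sum_(1 <= j < N.+1)
       integral_on Om (fun y => G y * u j y) * u j x) ^+ 2).
  (* the case of the form ip itself, with all eigenvalues 1 *)
  have [_ e] := form_residual (la := fun=> 1) N (square_integrable_lin_closed oOm)
    (ip_psd oOm) (ip_psd oOm) su (fun j G _ _ => esym (mul1r _))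
    orthonormal_eigenfunctions sG.
  set s := \sum_(1 <= j < N.+1) _ *: _ in e.
  have -> : integral_on Om (fun x => (G x - \sum_(1 <= j < N.+1)
       integral_on Om (fun y => G y * u j y) * u j x) ^+ 2) = ip (G - s) (G - s).
    apply: eq_Rintegral => x _; rewrite -expr2; congr (_ ^+ 2).
    rewrite -[RHS]/(G x - s x); congr (_ - _); rewrite /s fct_sumE.
    by apply: eq_bigr.
  rewrite e opprB addrC subrK; apply: eq_bigr => j _; exact/esym/mul1r.
rewrite (_ : (fun N => _) = (fun N => ip G G - integral_on Om (fun x =>
   (G x - \sum_(1 <= j < N.+1)
       integral_on Om (fun y => G y * u j y) * u j x) ^+ 2))); last exact/funext.
rewrite -[X in _ --> X]subr0; apply: cvgB; first exact: cvg_cst.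
exact: dense.
Qed.

Let Hu1 := H10_eigenfunction (ltn0Sn 0).
Let u1E G (HG : H10 Om G) := energy_eigenfunction (ltn0Sn 0) HG.
Let u11 : ip (u 1) (u 1) = 1 := orthonormal_eigenfunctions (ltn0Sn 0) (ltn0Sn 0).

Let HS := @H10_lin_closed R n Om oOm.
Let HP := H10_ip_psd oOm B0 OmB.
Let HE := H10_energy_psd oOm.
Let HV G (HG : H10 Om G) := parseval_eigenfunctions (H10_square_integrable oOm B0 OmB HG).
Let la12 := lambda1_lt2 spec.
Let la_nd := lambda_nondecreasing spec.

Let D_psd : psd_form (H10 Om) (defect ip energy la) :=
  defect_psd HS HP HE H10_eigenfunction energy_eigenfunction
    orthonormal_eigenfunctions HV la12 la_nd.

(** c puts the origin at the barycentre of the square of u 1, and q triangularizes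
    the matrix of the coefficients of x_i u_1 on u 2, u 3, and so on. *)
Lemma adapted_coordinates : exists (q : 'M[R]_n) (c : 'I_n -> R),
  let Z := rotated_coord_mul (u 1) q c in
  [/\ q *m q^T = 1%:M, forall i, ip (Z i) (u 1) = 0 &
      forall (i : 'I_n) j, (2 <= j <= i.+1)%N -> ip (Z i) (u j) = 0].
Proof.
pose b : 'M[R]_n := \matrix_(i, j) ip (coord_mul (u 1) i) (u j.+2).
have [q [qq qb]] := orthogonal_triangularization b.
pose c i := \sum_j q i j * ip (coord_mul (u 1) j) (u 1).
exists q, c => Z.
have E i j : (0 < j)%N -> ip (Z i) (u j) =
    \sum_k q i k * ip (coord_mul (u 1) k) (u j) - c i * (1%N == j)%:R.
  move=> j0; rewrite (form_rotated _ _ _ HS HP (H10_coord oOm B0 OmB Hu1) Hu1).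
    by rewrite orthonormal_eigenfunctions.
  exact: H10_eigenfunction.
split => // [i|i j]; first by rewrite E// eqxx mulr1 subrr.
move=> /andP[j2 ji]; rewrite E; last exact: leq_trans j2.
rewrite (_ : (1%N == j) = false) ?mulr0 ?subr0; last by case: j j2 {ji} => [|[|]].
have [j' jE] : exists j', j = j'.+2 by case: j j2 {ji} => [|[|j']]// _; exists j'.
have ji' : (j' < i)%N by move: ji; rewrite jE.
have jn : (j' < n)%N := ltn_trans ji' (ltn_ord i).
rewrite jE -[RHS](qb i (Ordinal jn) ji') mxE.
by apply: eq_bigr => k _; rewrite mxE.
Qed.

Lemma gap_bound : exists z : 'I_n -> 'rV[R]_n -> R, cartesian_coordinates z /\
  forall k l : nat, (0 < k)%N -> (0 < l)%N ->
    gap_sum la (coord_coef Om u z) k <=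
    3 * la 1%N + la 1%N ^+ 2 / sigma_coef la (coord_coef Om u z) l.
Proof.
have [q [c [qq Z1 Z0]]] := adapted_coordinates.
set Z := rotated_coord_mul (u 1) q c in Z1 Z0.
exists (fun i x => \sum_j q i j * x ord0 j - c i); split; first by exists q, c.
set a := coord_coef _ _ _.
have -> : a = fun i j => ip (Z i) (u j).
  apply/funext => i; apply/funext => j; apply: eq_Rintegral => x _.
  by rewrite /Z rotated_coord_mulE.
move=> k l k0 l0.
have HZ := H10_rotated oOm B0 OmB Hu1 q c.
have ZZ i j := defect_rotated_orthonormal oOm B0 OmB Hu1 u1E u11 c qq D_psd i j.
set sg := sigma_coef _ _ _.
have la0 : 0 < la 1 := lambda1_gt0 spec.
have lasg : la 1 < sg.
  exact: (sigma_gt HS HP HE H10_eigenfunction energy_eigenfunction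
    orthonormal_eigenfunctions HV la12 la_nd HZ ZZ l0).
pose r := (sg - la 1) / (sg + la 1).
have r0 : 0 < r by rewrite divr_gt0 ?subr_gt0// addr_gt0// (lt_trans la0).
pose phi := signed_power r (u 1).
have Hphi : H10 Om phi := H10_signed_power oOm OmB Hu1 r0.
pose m := ip phi (u 1); pose M := ip phi phi.
have m0 : 0 < m := ip_signed_power_gt0 oOm B0 OmB Hu1 u11 r0.
apply: (@le_trans _ _ (\sum_i (ip (Z i) (Z i))^-1)).
  apply: ler_sum => i _.
  have [I0 _] := rotated_moment_bound oOm B0 OmB Hu1 u11 c qq r0 i.
  have h := coordinate_gap HS HP HE H10_eigenfunction energy_eigenfunction
    orthonormal_eigenfunctions HV la12 la_nd HZ ZZ Z1 k (Z0 i).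
  have lak : 0 < la k.+1 - la 1.
    by rewrite subr_gt0; apply: (eigenvalue_gt la12 la_nd).
  have d0 : 0 < 1 + \sum_(i.+2 <= j < k.+1) (la k.+1 - la j) * ip (Z i) (u j) ^+ 2.
    by apply: lt_le_trans h; rewrite mulr_gt0.
  by rewrite ler_pdivrMr// mulrC ler_pdivlMr.
apply: le_trans (sum_inverse_moment oOm B0 OmB Hu1 u1E u11 c qq r0) _.
apply: (optimal_exponent la0 lasg m0); rewrite -/r.
pose G := phi - m *: u 1.
have Hm : H10 Om (m *: u 1).
  by have := HS m 0 Hu1 Hu1; rewrite scale0r addr0.
have HG : H10 Om G by exact: lin_closedB.
have linm F h : psd_form (H10 Om) F -> H10 Om h -> F h (m *: u 1) = m * F h (u 1).
  move=> HF Hh; have := form_linr HF m 0 Hu1 Hu1 Hh.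
  by rewrite scale0r addr0 mul0r addr0.
have Dself h : H10 Om h -> defect ip energy la h (u 1) = 0.
  by move=> Hh; rewrite /defect u1E// subrr.
have G1 : ip G (u 1) = 0.
  rewrite (formBl HP)// (form_sym HP (m *: _)) linm// u11.
  by rewrite mulr1 subrr.
have GZ i : defect ip energy la G (Z i) = 0.
  rewrite (formBl D_psd Hphi Hm (HZ i)) (form_sym D_psd (m *: _)).
  rewrite (linm _ _ D_psd (HZ i)) (Dself _ (HZ i)) mulr0 subr0.
  exact: (defect_signed_power_rotated oOm B0 OmB Hu1 u1E q c D_psd r0).
have := sigma_gap HS HP HE H10_eigenfunction energy_eigenfunction
    orthonormal_eigenfunctions HV la12 la_nd HZ ZZ l HG G1 GZ.
have -> : ip G G = M - m ^+ 2.
  rewrite {2}/G (formBr HP)// linm// G1 mulr0 subr0.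
  by rewrite (formBl HP)// (form_sym HP (m *: _)) linm// expr2.
have -> : defect ip energy la G G = defect ip energy la phi phi.
  rewrite {2}/G (formBr D_psd)// linm// Dself// mulr0 subr0.
  by rewrite (formBl D_psd)// (form_sym D_psd (m *: _)) linm// Dself// mulr0 subr0.
by rewrite /defect (energy_signed_power oOm OmB Hu1 u1E r0).
Qed.

End spectrum.

Theorem theorem2p1 (R : realType) (n : nat) (n_ge1 : (1 <= n)%N)
  (Omega : set 'rV[R]_n)
  (Omega_domain : domain Omega) (Omega_bounded : bounded_set Omega)
  (Omega_boundary : piecewise_smooth_boundary Omega)
  (lambda : nat -> R) (u : nat -> 'rV[R]_n -> R)
  (spectrum : dirichlet_spectrum Omega lambda u) :
  exists z : 'I_n -> 'rV[R]_n -> R, cartesian_coordinates z /\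
    forall k l : nat, (0 < k)%N -> (0 < l)%N ->
      gap_sum lambda (coord_coef Omega u z) k <=
      3 * lambda 1%N +
        lambda 1%N ^+ 2 / sigma_coef lambda (coord_coef Omega u z) l.
Proof.
have [oOm _ _] := Omega_domain.
have [B B0 OmB] := bounded_subset_box Omega_bounded.
exact: (gap_bound oOm B0 OmB spectrum).
Qed.
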